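(* Let $\mathbf{k}$ be a commutative ring, let $k\in\mathbb{N}$, and let $n\geq k$ be an integer. Let $\mathcal{S}$ be the ring of symmetric polynomials in $\mathbf{k}[x_1,x_2,\ldots,x_k]$. For each $i\in\{1,2,\ldots,k\}$, let $a_i\in\mathcal{S}$ be a symmetric polynomial of degree $<n-k+i$. Let $I$ be the ideal of $\mathcal{S}$ generated by the $k$ differences $h_{n-k+1}-a_1,\ h_{n-k+2}-a_2,\ \ldots,\ h_n-a_k$. Then the $\mathbf{k}$-module $\mathcal{S}/I$ is free with basis $\left(\overline{s_\lambda}\right)_{\lambda\in P_{k,n}}$.
   Context: $\mathbb{N}=\{0,1,2,\ldots\}$. The degree of a polynomial is its total degree; the zero polynomial counts as having degree smaller than every integer. $h_m$ is the $m$-th complete homogeneous symmetric polynomial in $x_1,\ldots,x_k$ (the sum of all monomials of degree $m$). A partition is a weakly decreasing infinite sequence of nonnegative integers with finitely many nonzero entries; its parts are its nonzero entries. $P_{k,n}$ is the set of all partitions that have at most $k$ parts and all of whose parts are $\leq n-k$. $s_\lambda=s_\lambda(x_1,\ldots,x_k)\in\mathcal{S}$ is the Schur polynomial of the partition $\lambda$ in $k$ variables. $\overline{m}$ denotes the residue class of $m\in\mathcal{S}$ in $\mathcal{S}/I$. *)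

(* Defs.v *)
From HB Require Import structures.
From mathcomp Require Import all_boot all_order all_fingroup all_algebra.
From mathcomp Require Import boolp.
From mathcomp Require Import mpoly.
From mathcomp Require Import zify.

Set Implicit Arguments.
Unset Strict Implicit.
Unset Printing Implicit Defensive.

Import GRing.Theory.
Local Open Scope ring_scope.
Local Open Scope quotient_scope.

Section Basis.
Variables (K : comNzRingType) (M : lmodType K) (J : Type) (b : J -> M).

(* The index type J may be infinite, so linear combinations run over finite
   injective subfamilies of b. *)
Definition lin_indep : Prop :=
  forall (m : nat) (f : 'I_m -> J) (c : 'I_m -> K), injective f ->
    \sum_(i < m) c i *: b (f i) = 0 -> forall i, c i = 0.

Definition spans : Prop :=
  forall x : M, exists (m : nat) (f : 'I_m -> J) (c : 'I_m -> K),
    x = \sum_(i < m) c i *: b (f i).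

Definition is_basis : Prop := lin_indep /\ spans.

End Basis.

Section GeneratedIdeal.
Variables (A : comNzRingType) (m : nat) (g : 'I_m -> A).

Definition gen_ideal : pred A :=
  fun x => `[< exists c : 'I_m -> A, x = \sum_(i < m) c i * g i >].

Lemma gen_ideal_zmod_closed : zmod_closed gen_ideal.
Proof.
split=> [|x y /asboolP [c ->] /asboolP [d ->]]; apply/asboolP.
  by exists (fun=> 0); rewrite big1 // => i _; rewrite mul0r.
exists (fun i => c i - d i); rewrite -sumrB.
by apply: eq_bigr => i _; rewrite mulrBl.
Qed.

HB.instance Definition _ :=
  GRing.isZmodClosed.Build A gen_ideal gen_ideal_zmod_closed.

End GeneratedIdeal.

Section QuotientModule.
Variables (K : comNzRingType) (A : comAlgType K) (m : nat) (g : 'I_m -> A).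

(* The library's quotient rings require a proper ideal, which is not known
   beforehand here, so the additive quotient is used and given its
   K-module structure below. *)
Let idealg : zmodClosed A := GRing.ZmodClosed.clone A (gen_ideal g) _.

Definition quo : Type := {ideal_quot idealg}.

HB.instance Definition _ := GRing.Zmodule.on quo.

Definition residue (x : A) : quo := \pi_({ideal_quot idealg}) x.

Lemma residueE (x y : A) : residue x = residue y <-> x - y \in gen_ideal g.
Proof.
rewrite /residue -[x - y \in gen_ideal g]/(x - y \in idealg) Quotient.idealrBE.
by split=> [->|/eqP].
Qed.

Lemma residue_surj (x : quo) : exists y, x = residue y.
Proof. by exists (generic_quotient.repr (x : {ideal_quot idealg})); rewrite /residue reprK. Qed.

Lemma residueD : {morph residue : x y / x + y}.
Proof. by move=> x y; rewrite /residue Quotient.pi_add. Qed.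

Lemma gen_idealZ c x : x \in gen_ideal g -> c *: x \in gen_ideal g.
Proof.
move=> /asboolP [d ->]; apply/asboolP; exists (fun i => c *: d i).
by rewrite scaler_sumr; apply: eq_bigr => i _; rewrite scalerAl.
Qed.

Definition quo_scale (c : K) (x : quo) : quo := residue (c *: generic_quotient.repr (x : {ideal_quot idealg})).

Lemma residueZ c x : residue (c *: x) = quo_scale c (residue x).
Proof.
apply/residueE; rewrite -scalerBr; apply: gen_idealZ.
by apply/residueE; rewrite /residue reprK.
Qed.

Lemma quo_scaleA c d x : quo_scale c (quo_scale d x) = quo_scale (c * d) x.
Proof. by have [y ->] := residue_surj x; rewrite -!residueZ scalerA. Qed.

Lemma quo_scale1 : left_id 1 quo_scale.
Proof. by move=> x; have [y ->] := residue_surj x; rewrite -residueZ scale1r. Qed.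

Lemma quo_scaleDr : right_distributive quo_scale +%R.
Proof.
move=> c x y; have [x' ->] := residue_surj x; have [y' ->] := residue_surj y.
by rewrite -residueD -!residueZ -residueD scalerDr.
Qed.

Lemma quo_scaleDl x : {morph quo_scale^~ x : c d / c + d}.
Proof.
by move=> c d; have [y ->] := residue_surj x; rewrite -!residueZ -residueD scalerDl.
Qed.

HB.instance Definition _ := GRing.Zmodule_isLmodule.Build K quo
  quo_scaleA quo_scale1 quo_scaleDr quo_scaleDl.

Lemma residue_is_linear : linear residue.
Proof. by move=> c x y; rewrite residueD residueZ. Qed.

HB.instance Definition _ :=
  GRing.isLinear.Build K A quo *:%R residue residue_is_linear.

End QuotientModule.

Section SymmetricRing.
Variables (K : comNzRingType) (k : nat).

Record sympoly : Type :=
  SymPoly { sympoly_val :> {mpoly K[k]}; _ : sympoly_val \is symmetric }.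

HB.instance Definition _ := [isSub for sympoly_val].
HB.instance Definition _ := [Choice of sympoly by <:].
HB.instance Definition _ := [SubChoice_isSubComNzRing of sympoly by <:].
HB.instance Definition _ := [SubZmodule_isSubLmodule of sympoly by <:].
HB.instance Definition _ :=
  [SubNzRing_SubLmodule_isSubLalgebra of sympoly by <:].
HB.instance Definition _ := GRing.Lalgebra_isComAlgebra.Build K sympoly.

End SymmetricRing.
(* msize p is 1 + (total degree of p), and 0 for p = 0. *)
Definition deg_lt (K : comNzRingType) (k : nat) (p : {mpoly K[k]}) (d : nat) :
  bool := (msize p <= d)%N.

Section CompleteHomogeneous.
Variables (K : comNzRingType) (k : nat).

Definition hsym (d : nat) : {mpoly K[k]} :=
  \sum_(m : 'X_{1..k < d.+1} | mdeg m == d) 'X_[m].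

Lemma mcoeff_hsym d (m : 'X_{1..k}) : (hsym d)@_m = (mdeg m == d)%:R.
Proof.
rewrite /hsym raddf_sum /=; have [md|md] := eqVneq (mdeg m) d.
  have lt_m : (mdeg m < d.+1)%N by rewrite md.
  rewrite (bigD1 (BMultinom lt_m)) /= ?md // mcoeffX eqxx big1 ?addr0 //.
  move=> m' /andP [_ nm]; rewrite mcoeffX; case: eqP => // E.
  by case/eqP: nm; apply: val_inj.
rewrite big1 // => m' /eqP E; rewrite mcoeffX; case: eqP => // E'.
by rewrite -E E' eqxx in md.
Qed.

Lemma hsym_sym d : hsym d \is symmetric.
Proof.
apply/issymP => s; apply/mpolyP => m.
by rewrite mcoeff_sym !mcoeff_hsym mdeg_mperm.
Qed.

Definition hS (d : nat) : sympoly K k := SymPoly (hsym_sym d).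

End CompleteHomogeneous.

(* A partition is encoded by the list of its parts, in decreasing order; the
   corresponding infinite sequence is (nth 0 la i), i = 0, 1, 2, ... *)
Definition is_part (la : seq nat) : bool := sorted geq la && (0%N \notin la).

Record intpart : Type := IntPart { parts :> seq nat; _ : is_part parts }.
HB.instance Definition _ := [isSub for parts].
HB.instance Definition _ := [Countable of intpart by <:].

Definition Pkn (k n : nat) : pred intpart :=
  fun la => (size la <= k)%N && all (fun x => x <= n - k)%N la.

(* Schur polynomials as generating functions of semistandard tableaux with
   entries in 'I_k, where the entry i stands for the variable 'X_i. *)
Section Tableaux.
Variables (K : comNzRingType) (k : nat).

(* The cells (i, j) with 0 <= i < size la and 0 <= j < la_i. *)
Definition cell (la : seq nat) : finType :=
  {i : 'I_(size la) & 'I_(nth 0%N la i)}.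
Definition crow (la : seq nat) (c : cell la) : nat := tag c.
Definition ccol (la : seq nat) (c : cell la) : nat := tagged c.

Definition ssyt (la : seq nat) (T : {ffun cell la -> 'I_k}) : bool :=
  [forall c, forall d,
    ((crow c == crow d) && (ccol c <= ccol d) ==> (T c <= T d))%N &&
    ((ccol c == ccol d) && (crow c < crow d) ==> (T c < T d))%N].

Definition schur (la : intpart) : {mpoly K[k]} :=
  \sum_(T : {ffun cell la -> 'I_k} | ssyt T) \prod_c 'X_(T c).

End Tableaux.
(* Symmetry of Schur polynomials, by the Bender-Knuth involutions: [toggle a]
   exchanges, row by row, the numbers of free entries a and a+1. *)
Section BenderKnuth.
Local Open Scope nat_scope.
Variable L : nat -> nat.
Hypothesis L_dec : forall i, L i.+1 <= L i.
Implicit Types (t : nat -> nat -> nat).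

Let cnt t i v := \sum_(j < L i) (t i j < v).

Definition bk_tab t :=
  (forall i j j', j <= j' -> j' < L i -> t i j <= t i j') /\
  (forall i j, j < L i.+1 -> t i j < t i.+1 j).

Lemma bk_segment (P : pred nat) n :
    (forall j j', j <= j' -> j' < n -> P j' -> P j) ->
  forall j, j < n -> (j < \sum_(i < n) P i) = P j.
Proof.
elim: n => [//|n IHn] P_down j lt_jn; rewrite big_ord_recr /=.
have Pd j1 j2 : (j1 <= j2 -> j2 < n -> P j2 -> P j1)%N.
  by move=> h1 h2; apply: P_down => //; lia.
have sum1 : \sum_(i < n) 1 = n by rewrite sum1_card card_ord.
have le_n : \sum_(i < n) P i <= n.
  by rewrite -[leqRHS]sum1; apply: leq_sum => i _; exact: leq_b1.
have [Pn|nPn] := boolP (P n).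
  have -> : \sum_(i < n) P i = n.
    rewrite -[RHS]sum1; apply: eq_bigr => i _.
    by rewrite (P_down i n) // ltnW.
  by rewrite addn1 lt_jn (P_down j n) //; lia.
rewrite addn0; have [lt_j|] := ltnP j n; first exact: (IHn Pd).
move=> le_nj; have -> : j = n by apply/eqP; rewrite eqn_leq le_nj andbT.
by rewrite (negbTE nPn) ltnNge le_n.
Qed.

Lemma bk_cnt_le t i v : cnt t i v <= L i.
Proof.
have sum1 : \sum_(j < L i) 1 = L i by rewrite sum1_card card_ord.
by rewrite -[leqRHS]sum1; apply: leq_sum => j _; exact: leq_b1.
Qed.

Lemma bk_cntP t i v j : bk_tab t -> j < L i -> (j < cnt t i v) = (t i j < v).
Proof.
move=> [t_row _] lt_j; rewrite /cnt (bk_segment (P := fun j => t i j < v)) //.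
by move=> j1 j2 le12 lt2; apply: leq_ltn_trans; exact: t_row.
Qed.

Lemma bk_cnt_mono t i v v' : v <= v' -> cnt t i v <= cnt t i v'.
Proof.
move=> le_v; apply: leq_sum => j _.
by case: (ltnP (t i j) v) => // h; rewrite (leq_trans h le_v).
Qed.

Lemma bk_cnt_inter t i v : bk_tab t -> cnt t i.+1 v.+1 <= cnt t i v.
Proof.
move=> tabt; case E: (cnt t i.+1 v.+1) => [//|j].
have ltj : j < L i.+1 by have := bk_cnt_le t i.+1 v.+1; lia.
have := bk_cntP v.+1 tabt ltj; rewrite E ltnSn => /esym h.
have ltj' : j < L i by have := L_dec i; lia.
rewrite (bk_cntP v tabt ltj'); case: tabt => _ /(_ i j ltj); lia.
Qed.

Lemma bk_tab_of t (g : nat -> nat -> nat) :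
    (forall i v, g i v <= L i) ->
    (forall i j v, j < L i -> (j < g i v) = (t i j < v)) ->
    (forall i v, g i.+1 v.+1 <= g i v) ->
  bk_tab t /\ forall i v, cnt t i v = g i v.
Proof.
move=> g_le gP g_int.
have tabt : bk_tab t.
  split=> [i j j' le_j lt_j'|i j lt_j].
    have := gP i j' (t i j').+1 lt_j'; rewrite ltnSn => h.
    by have := gP i j (t i j').+1 (leq_ltn_trans le_j lt_j'); lia.
  have lt_j' : j < L i by have := L_dec i; lia.
  have := gP i.+1 j (t i.+1 j).+1 lt_j; rewrite ltnSn => h.
  by rewrite -(gP i j _ lt_j') (leq_trans h).
split=> // i v; apply/eqP; rewrite eqn_leq; apply/andP; split.
  case E: (cnt t i v) => [//|j].
  have ltj : j < L i by have := bk_cnt_le t i v; lia.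
  by rewrite gP // -bk_cntP // E.
case E: (g i v) => [//|j].
have ltj : j < L i by have := g_le i v; lia.
by rewrite bk_cntP // -gP // E.
Qed.

Variable a : nat.

Let lo t i := maxn (cnt t i.+1 a.+2) (cnt t i a).
Let hi t i :=
  if i is i'.+1 then minn (cnt t i a.+2) (cnt t i' a) else cnt t i a.+2.
Let mid t i := lo t i + hi t i - cnt t i a.+1.

Definition toggle t i j :=
  if (cnt t i a <= j) && (j < cnt t i a.+2)
  then (if j < mid t i then a else a.+1) else t i j.

Let cnt' t i v := if v == a.+1 then mid t i else cnt t i v.

Lemma bk_bounds t i : bk_tab t ->
  [/\ cnt t i a <= lo t i, lo t i <= cnt t i a.+1,
      cnt t i a.+1 <= hi t i & hi t i <= cnt t i a.+2].
Proof.
move=> tabt; rewrite /lo /hi.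
have h1 := bk_cnt_mono t i (leqnSn a).
have h2 := bk_cnt_mono t i (leqnSn a.+1).
have h3 := bk_cnt_inter i a.+1 tabt.
case: i h1 h2 h3 => [|i] h1 h2 h3; first by split; lia.
by have h4 := bk_cnt_inter i a tabt; split; lia.
Qed.

Lemma bk_cnt_ext t t' : (forall i j, j < L i -> t i j = t' i j) ->
  forall i v, cnt t i v = cnt t' i v.
Proof. by move=> E i v; apply: eq_bigr => j _; rewrite E. Qed.

Lemma bk_toggle_ext t t' : (forall i j, j < L i -> t i j = t' i j) ->
  forall i j, j < L i -> toggle t i j = toggle t' i j.
Proof.
move=> E i j lt_j; have Ec := bk_cnt_ext E.
rewrite /toggle /mid /lo /hi !Ec E //.
by case: i lt_j => [|i] lt_j; rewrite ?Ec.
Qed.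

Lemma bk_toggle_tab t : bk_tab t ->
  bk_tab (toggle t) /\ forall i v, cnt (toggle t) i v = cnt' t i v.
Proof.
move=> tabt; apply: bk_tab_of => [i v|i j v lt_j|i v].
- rewrite /cnt'; case: eqP => _; last exact: bk_cnt_le.
  by have [] := bk_bounds i tabt; have := bk_cnt_le t i a.+2; rewrite /mid; lia.
- have [b1 b2 b3 b4] := bk_bounds i tabt.
  have c0 := bk_cntP a tabt lt_j; have c2 := bk_cntP a.+2 tabt lt_j.
  have cv := bk_cntP v tabt lt_j.
  rewrite /cnt' /toggle; case: eqP => [->|/eqP nv].
    by case: ifP => [|]; [case: ifP|]; rewrite /mid; lia.
  by rewrite cv; case: ifP => [|]; [case: ifP|]; lia.
- have [b1 b2 b3 b4] := bk_bounds i tabt.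
  have [d1 d2 d3 d4] := bk_bounds i.+1 tabt.
  rewrite /cnt' /mid; case: eqP => [E|_]; case: eqP => [E'|_].
  + lia.
  + have -> : v = a by lia.
    by move: d1 d2 d3 d4; rewrite /hi; lia.
  + by move: b1 b2 b3 b4; rewrite E' /lo; lia.
  + exact: bk_cnt_inter.
Qed.

Lemma bk_toggleK t : bk_tab t ->
  forall i j, j < L i -> toggle (toggle t) i j = t i j.
Proof.
move=> tabt i j lt_j.
have [tab1 E1] := bk_toggle_tab tabt; have [tab2 E2] := bk_toggle_tab tab1.
have E i' v : cnt (toggle (toggle t)) i' v = cnt t i' v.
  rewrite E2 /cnt'; case: eqP => [->|/eqP nv]; last by rewrite E1 /cnt' (negbTE nv).
  have [b1 b2 b3 b4] := bk_bounds i' tabt.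
  have Ea i1 : cnt (toggle t) i1 a = cnt t i1 a.
    by rewrite E1 /cnt'; case: eqP => //; lia.
  have Eaa i1 : cnt (toggle t) i1 a.+2 = cnt t i1 a.+2.
    by rewrite E1 /cnt'; case: eqP => //; lia.
  have Elo : lo (toggle t) i' = lo t i' by rewrite /lo Ea Eaa.
  have Ehi : hi (toggle t) i' = hi t i' by rewrite /hi; case: (i') => *; rewrite ?Ea Eaa.
  by rewrite {1}/mid Elo Ehi E1 /cnt' eqxx /mid; lia.
have h v : (toggle (toggle t) i j < v) = (t i j < v).
  by rewrite -(bk_cntP v tab2 lt_j) -(bk_cntP v tabt lt_j) E.
have := h (t i j).+1; have := h (t i j); lia.
Qed.

Lemma bk_sum_bounds t n :
  \sum_(i < n.+1) (lo t i + hi t i) =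
  \sum_(i < n.+1) cnt t i a.+2 + \sum_(i < n) cnt t i a + lo t n.
Proof.
elim: n => [|n IHn].
  by rewrite !big_ord_recr !big_ord0 /= !add0n addn0 addnC.
rewrite big_ord_recr IHn [in RHS]big_ord_recr /= [\sum_(i < n.+1) cnt t i a]big_ord_recr /=.
by rewrite [lo t n]/lo; lia.
Qed.

Lemma bk_sum_mid t n : L n = 0 -> bk_tab t ->
  \sum_(i < n) mid t i + \sum_(i < n) cnt t i a.+1 =
  \sum_(i < n) cnt t i a + \sum_(i < n) cnt t i a.+2.
Proof.
move=> Ln tabt; rewrite -big_split /=.
rewrite (eq_bigr (fun i : 'I_n => lo t i + hi t i)) => [|i _]; last first.
  by have [] := bk_bounds i tabt; rewrite /mid; lia.
case: n Ln => [|n] Ln; first by rewrite !big_ord0.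
rewrite bk_sum_bounds [\sum_(i < n.+1) cnt t i a]big_ord_recr /=.
have Ec : cnt t n.+1 a.+2 = 0 by have := bk_cnt_le t n.+1 a.+2; lia.
by rewrite /lo Ec max0n -addnA addnC.
Qed.

Lemma bk_total t n v : L n = 0 -> bk_tab t ->
  \sum_(i < n) cnt (toggle t) i v + (v == a.+1) * \sum_(i < n) cnt t i v =
  if v == a.+1 then \sum_(i < n) cnt t i a + \sum_(i < n) cnt t i a.+2
  else \sum_(i < n) cnt t i v.
Proof.
move=> Ln tabt; have [_ E] := bk_toggle_tab tabt.
rewrite (eq_bigr (fun i : 'I_n => cnt' t i v)) => [|i _]; last exact: E.
rewrite /cnt'; have [->|_] := eqVneq; last by rewrite mul0n addn0.
by rewrite mul1n bk_sum_mid.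
Qed.

End BenderKnuth.

Section SchurSymmetric.
Variables (K : comNzRingType) (k : nat) (la : intpart).
Implicit Types (T : {ffun cell la -> 'I_k}).

Let L i := nth 0%N la i.

Lemma part_dec i : (L i.+1 <= L i)%N.
Proof.
rewrite /L; case: la => s /= /andP [s_sorted _].
have [lt_i|ge_i] := ltnP i.+1 (size s); last by rewrite nth_default.
have s_trans : transitive geq by move=> x y z /= h1 h2; apply: leq_trans h2 h1.
exact: (sorted_ltn_nth s_trans 0%N s_sorted i i.+1 (ltnW lt_i) lt_i (ltnSn i)).
Qed.

Lemma cell_inj (c d : cell la) : crow c = crow d -> ccol c = ccol d -> c = d.
Proof.
case: c d => [i j] [i' j']; rewrite /crow /ccol /= => /val_inj E.
by case: i' / E j' => j' /val_inj ->.
Qed.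

Lemma cell_lt (c : cell la) : (ccol c < L (crow c))%N.
Proof. exact: ltn_ord. Qed.

Lemma cell_ex i j : (j < L i)%N -> exists c : cell la, crow c = i /\ ccol c = j.
Proof.
move=> lt_j; have lt_i : (i < size la)%N.
  by rewrite ltnNge; apply/negP => ge_i; rewrite /L nth_default in lt_j.
by exists (existT _ (Ordinal lt_i) (Ordinal (lt_j : (j < L (Ordinal lt_i))%N))).
Qed.

Let ext T i j : nat :=
  if [pick c | (crow c == i) && (ccol c == j)] is Some c then T c else 0%N.

Lemma extE T c : ext T (crow c) (ccol c) = T c.
Proof.
rewrite /ext; case: pickP => [d /andP [/eqP h1 /eqP h2]|/(_ c)].
  by rewrite (cell_inj h1 h2).
by rewrite !eqxx.
Qed.

Lemma ssyt_tab T : ssyt T -> bk_tab L (ext T).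
Proof.
move=> /forallP ssT; split=> [i j j' le_j lt_j'|i j lt_j].
  have [c [Ec Ec']] := cell_ex (leq_ltn_trans le_j lt_j').
  have [d [Ed Ed']] := cell_ex lt_j'.
  rewrite -{1}Ec -Ec' -Ed -Ed' !extE.
  have /forallP/(_ d)/andP [/implyP h _] := ssT c; apply: h.
  by rewrite Ec Ed Ec' Ed' eqxx.
have [d [Ed Ed']] := cell_ex lt_j.
have [c [Ec Ec']] := cell_ex (leq_trans lt_j (part_dec i)).
rewrite -Ed -{1}Ec -{1}Ec' -Ed' !extE.
have /forallP/(_ d)/andP [_ /implyP h] := ssT c; apply: h.
by rewrite Ec' Ed' eqxx Ec Ed /=.
Qed.

Lemma tab_ssyt T t : (forall c, T c = t (crow c) (ccol c) :> nat) ->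
  bk_tab L t -> ssyt T.
Proof.
move=> ET [t_row t_col]; apply/forallP => c; apply/forallP => d.
apply/andP; split; apply/implyP => /andP [/eqP E le_cd]; rewrite !ET.
  by rewrite E; apply: t_row => //; exact: cell_lt.
move: le_cd (cell_lt d); rewrite E; move: (crow c) (crow d) (ccol d) => i i' j.
elim: i' => [//|i' IH]; rewrite ltnS leq_eqVlt => /orP [/eqP ->|lt_i] lt_j.
  exact: t_col.
have lt_j' := leq_trans lt_j (part_dec i').
by apply: ltn_trans (IH lt_i lt_j') (t_col _ _ lt_j).
Qed.

Variable a : nat.
Hypothesis lt_a : (a.+1 < k)%N.

Let tog T : {ffun cell la -> 'I_k} :=
  [ffun c => insubd (T c) (toggle L a (ext T) (crow c) (ccol c))].

Lemma togE T c : tog T c = toggle L a (ext T) (crow c) (ccol c) :> nat.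
Proof.
rewrite ffunE val_insubd ifT // /toggle extE.
by do 2?case: ifP => // _; exact: ltnW.
Qed.

Lemma ext_tog T i j : (j < L i)%N -> ext (tog T) i j = toggle L a (ext T) i j.
Proof. by move=> /cell_ex [c [<- <-]]; rewrite extE togE. Qed.

Lemma tog_ssyt T : ssyt T -> ssyt (tog T).
Proof.
move=> /ssyt_tab /(bk_toggle_tab part_dec a) [tabT _].
by apply: tab_ssyt tabT => c; exact: togE.
Qed.

Lemma togK T : ssyt T -> tog (tog T) = T.
Proof.
move=> /ssyt_tab tabT; apply/ffunP => c; apply: val_inj => /=.
rewrite togE (bk_toggle_ext _ (@ext_tog T)) ?cell_lt //.
by rewrite (bk_toggleK part_dec) ?cell_lt ?extE.
Qed.

Lemma sum_cell T v :
  (\sum_(c : cell la) (T c < v) =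
   \sum_(i < size la) \sum_(j < L i) (ext T i j < v))%N.
Proof.
rewrite sig_big_dep /=; apply: eq_bigr => c _.
by rewrite -(extE T c).
Qed.

Let s : 'S_k := tperm (Ordinal (ltnW lt_a)) (Ordinal lt_a).

Lemma tog_weight T (v : 'I_k) : ssyt T ->
  (\sum_c (tog T c == v) = \sum_c (s (T c) == v))%N.
Proof.
move=> /ssyt_tab tabT.
have L0 : L (size la) = 0%N by rewrite /L nth_default.
pose G T' v := (\sum_c (T' c < v))%N.
have wt T' (u : 'I_k) : (G T' u + \sum_c (T' c == u) = G T' u.+1)%N.
  rewrite /G -big_split /=; apply: eq_bigr => c _.
  by rewrite -val_eqE /=; lia.
have tot u : (G (tog T) u + (u == a.+1) * G T u =
    if u == a.+1 then G T a + G T a.+2 else G T u)%N.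
  have := bk_total part_dec a u L0 tabT; rewrite /G !sum_cell => <-.
  congr (_ + _)%N; apply: eq_bigr => i _; apply: eq_bigr => j _.
  by rewrite ext_tog.
have sE : (\sum_c (s (T c) == v) = \sum_c (T c == s v))%N.
  by apply: eq_bigr => c _; rewrite -(inj_eq (@perm_inj _ s)) tpermK.
rewrite sE.
have w1 := wt (tog T) v; have w2 := wt T (s v).
have t1 := tot v; have t2 := tot v.+1.
have E0 : (G T a + \sum_c (T c == Ordinal (ltnW lt_a)) = G T a.+1)%N.
  exact: wt.
move: w2 t1 t2; rewrite /s; case: tpermP => [Ev|Ev|n1 n2] w2 t1 t2.
- have Ev' : nat_of_ord v = a by rewrite Ev.
  rewrite Ev' in w1 t1 t2.
  move: t1 t2 w2 w1; rewrite eqxx mul1n; case: eqP => [|_]; first lia.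
  by rewrite mul0n /=; lia.
- have Ev' : nat_of_ord v = a.+1 by rewrite Ev.
  rewrite Ev' in w1 t1 t2.
  move: t1 t2 w2 w1; rewrite eqxx mul1n; case: eqP => [|_]; first lia.
  by rewrite mul0n /=; lia.
- have n1' : nat_of_ord v <> a by move=> E; case: n1; apply: val_inj.
  have n2' : nat_of_ord v <> a.+1 by move=> E; case: n2; apply: val_inj.
  move: t1 t2; case: eqP => [//|_]; case: eqP => [[]//|_].
  by rewrite !mul0n; lia.
Qed.

Lemma prodX_count (F : cell la -> 'I_k) :
  \prod_c 'X_(F c) = \prod_v 'X_v ^+ (\sum_c (F c == v)) :> {mpoly K[k]}.
Proof.
under [RHS]eq_bigr => v _ do rewrite -prodrXr.
rewrite exchange_big /=; apply: eq_bigr => c _.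
rewrite (bigD1 (F c)) //= eqxx expr1 big1 ?mulr1 // => v nv.
by rewrite eq_sym (negbTE nv) expr0.
Qed.

Lemma msym_schur_adj : msym s (schur K k la) = schur K k la.
Proof.
have msymX1 i : msym s 'X_i = 'X_(s i) :> {mpoly K[k]}.
  by rewrite /msym mmapX mmap1U.
rewrite /schur raddf_sum /= [RHS](reindex_onto tog tog) /=; last exact: togK.
apply: eq_big => [T|T ssT].
  apply/idP/andP => [ssT|[ssT /eqP <-]]; last exact: tog_ssyt.
  by rewrite tog_ssyt // togK.
rewrite rmorph_prod /=; under eq_bigr => c _ do rewrite msymX1.
rewrite (prodX_count (fun c => s (T c))) (prodX_count (tog T)).
by apply: eq_bigr => v _; rewrite tog_weight.
Qed.

End SchurSymmetric.

Lemma schur_sym (K : comNzRingType) (k : nat) (la : intpart) :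
  schur K k la \is symmetric.
Proof.
set p := schur K k la.
have M s1 s2 : msym s1 p = p -> msym s2 p = p -> msym (s1 * s2)%g p = p.
  by move=> h1 h2; rewrite msymMm h1 h2.
have tp n : forall i j : 'I_k, j = (i + n)%N :> nat -> msym (tperm i j) p = p.
  elim: n => [|n IHn] i j Eij.
    have -> : j = i by apply: val_inj; rewrite /= Eij addn0.
    by rewrite tperm1 msym1m.
  have lt_j : (i + n < k)%N by rewrite -ltnS -addnS -Eij ltnS ltnW.
  have lt_a : ((i + n).+1 < k)%N by rewrite -addnS -Eij.
  have -> : j = Ordinal lt_a by apply: val_inj; rewrite /= Eij addnS.
  have := msym_schur_adj K la lt_a; set s := tperm _ _ => Es.
  have [n0|n_gt0] := posnP n.
    suff -> : tperm i (Ordinal lt_a) = s by [].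
    by congr tperm; apply: val_inj; rewrite /= n0 addn0.
  have -> : tperm i (Ordinal lt_a) = (s * (tperm i (Ordinal lt_j) * s))%g.
    have Ej : Ordinal lt_j = Ordinal (ltnW lt_a) by exact: val_inj.
    have -> : tperm i (Ordinal lt_a) = (tperm i (Ordinal lt_j) ^ s)%g.
      rewrite tpermJ Ej /s tpermL tpermD // -val_eqE /=; first by lia.
      by rewrite gtn_eqF // ltnS leq_addr.
    by rewrite /conjg /s tpermV.
  apply: (M _ _ Es); apply: (M _ _ _ Es); exact: IHn.
have tpa i j : msym (tperm i j) p = p.
  have [le_ij|lt_ji] := leqP i j; first by apply: (tp (j - i)%N); rewrite subnKC.
  by rewrite tpermC; apply: (tp (i - j)%N); rewrite subnKC // ltnW.
apply/issymP => s; have [ts -> _] := prod_tpermP s.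
elim: ts => [|[i j] ts IH]; first by rewrite big_nil msym1m.
by rewrite big_cons; apply: M => //; exact: tpa.
Qed.

Definition schurS (K : comNzRingType) (k : nat) (la : intpart) : sympoly K k :=
  SymPoly (schur_sym K k la).

(* Main.v *)
(* Spanning. Write A for the antisymmetrization and d = (k-1, ..., 1, 0).
   Multiplication by the Vandermonde alternant A(x^d) is injective, and it
   sends a symmetric f to A(x^d f), a combination of alternants A(x^m). If all
   exponents of m are < n, then A(x^m) is A(x^d) times a combination of the s_la
   with la in the box: the expansion of A(x^d) s_la over tableaux is A(x^(d+la))
   plus alternants A(x^m') with a smaller sum of squares of exponents. If some
   exponent is >= n, then A(x^m) is a combination of h_{n-k+1}, ..., h_n with
   coefficients in A(x^d) S, because x_i^n lies in the ideal of the polynomial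
   ring generated by these h's. Replacing h_{n-k+i} by a_i lowers the degree, so
   induction on the degree finishes.
   Independence. The generators h_{n-k+i} - a_i generate the same ideal of the
   full polynomial ring as polynomials g_0, ..., g_{k-1} with leading monomials
   x_j^(n-k+j+1), obtained by eliminating variables. A nonzero element of this
   ideal has a monomial divisible by one of these, whereas in a combination of
   the s_la with la in the box all exponents are <= n-k. *)
From HB Require Import structures.
Require Import Defs.
From mathcomp Require Import all_boot all_order all_fingroup all_algebra.
From mathcomp Require Import ssrcomplements mpoly.
From mathcomp Require Import zify.
From mathcomp Require boolp.

Set Implicit Arguments.
Unset Strict Implicit.
Unset Printing Implicit Defensive.

Import Order.TTheory GRing.Theory.
Local Open Scope ring_scope.

Lemma sum_bool_card (T : finType) (P : pred T) :
  (\sum_x P x = #|[set x | P x]|)%N.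
Proof.
by rewrite -sum1dep_card [RHS]big_mkcond; apply: eq_bigr => x _; case: (P x).
Qed.

(** * Weights of semistandard tableaux *)

Section TableauWeights.
Local Open Scope nat_scope.
Variables (k : nat) (la : intpart).
Implicit Types (T : {ffun cell la -> 'I_k}) (c d : cell la).

Definition part_mnm : 'X_{1..k} := [multinom nth 0 la i | i < k].

Definition weight T : 'X_{1..k} := [multinom \sum_c (T c == v) | v < k].

Lemma part_nth_le i j : i <= j -> nth 0 la j <= nth 0 la i.
Proof.
move=> /subnKC <-; elim: (j - i) => [|r IH]; first by rewrite addn0.
by rewrite addnS; apply: leq_trans (part_dec la _) IH.
Qed.

(** Columns increase strictly, so going down a column adds at least one per row. *)
Lemma ssyt_row_le T c : ssyt T -> crow c <= T c.
Proof.
move=> ssT; move Er: (crow c) => r.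
elim: r c Er => [//|r IH] c Er.
have lt_c : ccol c < nth 0 la r.
  by apply: leq_trans (part_dec la r); rewrite -Er; exact: cell_lt.
have [d [Ed Ed']] := cell_ex lt_c.
apply: leq_ltn_trans (IH d Ed) _.
have /forallP/(_ d)/forallP/(_ c)/andP[_ /implyP] := ssT; apply.
by rewrite Ed' eqxx Ed Er /=.
Qed.

Lemma ssyt_col_inj T c d : ssyt T -> T c = T d -> ccol c = ccol d -> c = d.
Proof.
move=> ssT ET Ecol; apply: cell_inj => //.
have strict c1 d1 : ccol c1 = ccol d1 -> crow c1 < crow d1 -> T c1 < T d1.
  move=> E lt; have /forallP/(_ c1)/forallP/(_ d1)/andP[_ /implyP] := ssT.
  by apply; rewrite E eqxx.
case: (ltngtP (crow c) (crow d)) => // lt.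
  by have := strict _ _ Ecol lt; rewrite ET ltnn.
by have := strict _ _ (esym Ecol) lt; rewrite ET ltnn.
Qed.

Lemma sum_weight (f : 'I_k -> nat) T :
  \sum_v f v * weight T v = \sum_c f (T c).
Proof.
under eq_bigr => v _ do rewrite mnmE big_distrr.
rewrite exchange_big /=; apply: eq_bigr => c _.
rewrite (bigD1 (T c)) //= eqxx muln1 big1 ?addn0 // => v ne_v.
by rewrite eq_sym (negPf ne_v) muln0.
Qed.

Lemma mdeg_weight T : mdeg (weight T) = \sum_(c : cell la) 1.
Proof.
rewrite mdegE -(sum_weight (fun=> 1) T).
by apply: eq_bigr => v _; rewrite mul1n.
Qed.

(** Cells with equal entries lie in distinct columns, and there are [nth 0 la 0] columns. *)
Lemma weight_le_row T v : ssyt T -> weight T v <= nth 0 la 0.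
Proof.
move=> ssT; rewrite mnmE sum_bool_card.
have lt_c c : ccol c < nth 0 la 0.
  by apply: leq_trans (cell_lt c) _; exact: part_nth_le.
rewrite -(card_in_imset (f := fun c => Ordinal (lt_c c))).
  by rewrite -[leqRHS]card_ord max_card.
move=> c d; rewrite !inE => /eqP Ec /eqP Ed [E].
by apply: (ssyt_col_inj ssT) => //; rewrite Ec Ed.
Qed.

Let before T c := \sum_d ((T c == T d) && (ccol d < ccol c)).

Lemma before_le T c : ssyt T -> before T c <= ccol c.
Proof.
move=> ssT; rewrite /before sum_bool_card.
pose f d := insub (ccol d) : option 'I_(ccol c).
rewrite -(card_in_imset (f := f)); last first.
  move=> d1 d2; rewrite !inE => /andP[/eqP E1 l1] /andP[/eqP E2 l2].
  rewrite /f !insubT => -[E]; apply: (ssyt_col_inj ssT) => //.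
  by rewrite -E1 -E2.
apply: (@leq_trans #|[set Some j | j : 'I_(ccol c)]|); last first.
  by rewrite card_imset ?card_ord //; exact: Some_inj.
apply/subset_leq_card/subsetP => x /imsetP [d]; rewrite inE => /andP[_ l1] ->.
by rewrite /f insubT; apply: imset_f.
Qed.

(** The sum of squares counts ordered pairs of cells with equal entries. Two distinct such cells lie
    in different columns, so exactly one is to the left of the other; this accounts for the
    doubling. *)
Lemma sum_weight_sqr T : ssyt T ->
  \sum_v weight T v ^ 2 = (\sum_c before T c).*2 + \sum_(c : cell la) 1.
Proof.
move=> ssT.
have -> : \sum_v weight T v ^ 2 = \sum_c \sum_d (T c == T d).
  under eq_bigr => v _ do rewrite -mulnn.
  rewrite sum_weight; apply: eq_bigr => c _; rewrite mnmE.
  by apply: eq_bigr => d _; rewrite eq_sym.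
have Eswap : \sum_c before T c = \sum_c \sum_d ((T c == T d) && (ccol c < ccol d)).
  rewrite /before exchange_big; apply: eq_bigr => c _.
  by apply: eq_bigr => d _; rewrite eq_sym.
rewrite -addnn {2}Eswap /before -!big_split; apply: eq_bigr => c _ /=.
rewrite -big_split (bigD1 c) //= [in RHS](bigD1 c) //= eqxx !ltnn add0n addnC.
congr (_ + _); apply: eq_bigr => d ne_d.
have [E|//] := eqVneq (T c) (T d).
case: ltngtP => // Ecol; case/eqP: ne_d.
by rewrite (ssyt_col_inj ssT E).
Qed.

Hypothesis le_k : size la <= k.

Definition row_tableau : {ffun cell la -> 'I_k} :=
  [ffun c => widen_ord le_k (tag c)].

Lemma row_tableauE c : row_tableau c = crow c :> nat.
Proof. by rewrite ffunE. Qed.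

Lemma row_tableau_ssyt : ssyt row_tableau.
Proof.
apply/forallP => c; apply/forallP => d; rewrite !row_tableauE.
by apply/andP; split; apply/implyP => /andP[/eqP E] // _; rewrite E.
Qed.

Lemma weight_row_tableau : weight row_tableau = part_mnm.
Proof.
apply/mnmP => v; rewrite !mnmE.
have -> : \sum_c (row_tableau c == v) =
    \sum_(i < size la) \sum_(j < nth 0 la i) (i == v :> nat).
  rewrite sig_big_dep /=; apply: eq_bigr => c _.
  by rewrite -val_eqE /= row_tableauE.
under eq_bigr => i _ do rewrite sum_nat_const card_ord.
have [lt_v|ge_v] := ltnP v (size la).
  rewrite (bigD1 (Ordinal lt_v)) //= eqxx muln1 big1 ?addn0 // => i ne_i.
  by rewrite -[_ == _ :> nat]/(i == Ordinal lt_v) (negPf ne_i) muln0.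
rewrite nth_default // big1 // => i _.
by rewrite [_ == _]ltn_eqF ?muln0 // (leq_trans (ltn_ord i)).
Qed.

Lemma mdeg_weight_ssyt T : mdeg (weight T) = mdeg part_mnm.
Proof. by rewrite -weight_row_tableau !mdeg_weight. Qed.

Lemma ssyt_sum_rows T : ssyt T ->
  \sum_(c : cell la) crow c <= \sum_(c : cell la) T c ?= iff (T == row_tableau).
Proof.
move=> ssT.
have := @leqif_sum _ predT (fun c => crow c == T c) (@crow la)
  (fun c => T c : nat) (fun c _ => leqif_eq (ssyt_row_le c ssT)).
congr (_ <= _ ?= iff _); apply/forallP/eqP => [h|-> c /=]; last first.
  by rewrite row_tableauE.
by apply/ffunP => c; apply/val_inj/esym; rewrite /= row_tableauE; apply/eqP/h.
Qed.

(** The weight determines the sum of the entries, and only the row tableau minimizes that sum. *)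
Lemma weight_eq_part T : ssyt T -> (weight T == part_mnm) = (T == row_tableau).
Proof.
move=> ssT; apply/eqP/eqP => [E|->]; last exact: weight_row_tableau.
apply/eqP; rewrite -(ssyt_sum_rows ssT) -(sum_weight (fun v : 'I_k => v : nat)).
rewrite E -weight_row_tableau (sum_weight (fun v : 'I_k => v : nat)).
by apply/eqP/eq_bigr => c _; rewrite row_tableauE.
Qed.

(** Both sides are sums of tableau entries. This is the triangularity behind both spanning and
    independence. *)
Lemma weight_cost T : ssyt T -> weight T != part_mnm ->
  \sum_(v < k) v * part_mnm v < \sum_(v < k) v * weight T v.
Proof.
move=> ssT; rewrite weight_eq_part // -weight_row_tableau.
rewrite !(sum_weight (fun v : 'I_k => v : nat)).
under [X in _ -> X < _]eq_bigr => c _ do rewrite row_tableauE.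
by rewrite (ltn_leqif (ssyt_sum_rows ssT)).
Qed.

(* Equal entries lie in distinct columns, so at most ccol c of the cells with
   the same entry as c are to the left of c; in the row tableau, exactly ccol c. *)
Lemma weight_sqr_le T : ssyt T ->
  \sum_v weight T v ^ 2 <= \sum_v part_mnm v ^ 2.
Proof.
move=> ssT; rewrite -weight_row_tableau !sum_weight_sqr ?row_tableau_ssyt //.
rewrite leq_add2r leq_double; apply: leq_sum => c _.
apply: leq_trans (before_le c ssT) _.
have lt_c (j : 'I_(ccol c)) : j < nth 0 la (tag c).
  exact: ltn_trans (ltn_ord j) (cell_lt c).
pose f j : cell la := Tagged (fun i : 'I_(size la) => 'I_(nth 0 la i)) (Ordinal (lt_c j)).
rewrite /before sum_bool_card.
apply: (@leq_trans #|[set f j | j : 'I_(ccol c)]|).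
  rewrite card_imset ?card_ord // => j1 j2 /(congr1 (@ccol la)) E.
  exact/val_inj/E.
apply/subset_leq_card/subsetP => d /imsetP [j _ ->].
by rewrite !inE -val_eqE /= !row_tableauE eqxx; exact: (ltn_ord j).
Qed.

End TableauWeights.

(** * Coefficients of Schur polynomials *)

Section SchurCoefficients.
Variables (K : comNzRingType) (k : nat) (la : intpart).

Lemma schur_weightE :
  schur K k la = \sum_(T : {ffun cell la -> 'I_k} | ssyt T) 'X_[weight T].
Proof.
apply: eq_bigr => T _; rewrite (prodX_count K (fun c => T c)) [RHS]mpolyXE_id.
by apply: eq_bigr => v _; rewrite mnmE.
Qed.

Lemma schur_supp m : (schur K k la)@_m != 0 ->
  exists2 T : {ffun cell la -> 'I_k}, ssyt T & weight T = m.
Proof.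
rewrite schur_weightE raddf_sum /= => nz.
have [/existsP [T /andP[ssT /eqP]]|] :=
  boolP [exists T : {ffun cell la -> 'I_k}, ssyt T && (weight T == m)].
  by exists T.
rewrite negb_exists => /forallP h; case/eqP: nz; rewrite big1 // => T ssT.
by rewrite mcoeffX; have := h T; rewrite ssT /= => /negPf ->.
Qed.

Lemma schur_part : (size la <= k)%N -> (schur K k la)@_(part_mnm k la) = 1.
Proof.
move=> le_k; rewrite schur_weightE raddf_sum /=.
rewrite (bigD1 (row_tableau le_k)) ?row_tableau_ssyt //=.
rewrite mcoeffX weight_row_tableau eqxx big1 ?addr0 // => T /andP[ssT neT].
by rewrite mcoeffX weight_eq_part // (negPf neT).
Qed.

End SchurCoefficients.

(** * Alternants and the Vandermonde determinant *)

Section Alternants.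
Variables (K : comNzRingType) (k : nat).
Implicit Types (p q : {mpoly K[k]}) (m : 'X_{1..k}).

Definition antisym p : {mpoly K[k]} := \sum_(s : 'S_k) (-1) ^+ s *: msym s p.

Lemma antisym_is_linear : linear antisym.
Proof.
move=> c p q; rewrite /antisym scaler_sumr -big_split; apply: eq_bigr => s _ /=.
by rewrite msymD msymZ scalerDr !scalerA mulrC.
Qed.

HB.instance Definition _ :=
  GRing.isLinear.Build K {mpoly K[k]} {mpoly K[k]} *:%R antisym antisym_is_linear.

Lemma antisym_symM p q : q \is symmetric -> antisym (p * q) = antisym p * q.
Proof.
move=> /issymP sym_q; rewrite /antisym mulr_suml; apply: eq_bigr => s _.
by rewrite msymM sym_q scalerAl.
Qed.

(** The sum is the Leibniz expansion; a determinant with two equal rows vanishes over any ring,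
    without division by 2. *)
Lemma antisymX m : antisym 'X_[m] = \det (\matrix_(i < k, j < k) 'X_j ^+ m i).
Proof.
apply: eq_bigr => s _; rewrite -mul_mpolyC rmorphXn rmorphN rmorph1.
congr (_ * _); rewrite /msym mmapX /mmap1.
by apply: eq_bigr => i _; rewrite mxE.
Qed.

Lemma antisymX_eq0 m (i j : 'I_k) : i != j -> m i = m j -> antisym 'X_[m] = 0.
Proof.
move=> ne_ij E; rewrite antisymX (determinant_alternate ne_ij) // => l.
by rewrite !mxE E.
Qed.

Lemma antisymX_perm m (s : 'S_k) :
  antisym 'X_[[multinom m (s i) | i < k]] = (-1) ^+ s *: antisym 'X_[m].
Proof.
rewrite !antisymX -mul_mpolyC rmorphXn rmorphN rmorph1 -det_perm -det_mulmx.
by congr (\det _); rewrite -row_permE; apply/matrixP => i j; rewrite !mxE mnmE.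
Qed.

Definition staircase : 'X_{1..k} := [multinom (k.-1 - i)%N | i < k].

(** Up to the sign of reversing the rows, this is a Vandermonde determinant, a product of
    differences of variables. Each difference has leading coefficient 1 or -1, hence is regular even
    if [K] has zero divisors. *)
Lemma antisym_staircase_lreg : GRing.lreg (antisym 'X_[staircase]).
Proof.
have -> : antisym 'X_[staircase] =
    (-1) ^+ perm (@rev_ord_inj k) * \det (Vandermonde k (\row_i 'X_i)).
  rewrite antisymX -det_perm -det_mulmx -row_permE.
  congr (\det _); apply/matrixP => i j; rewrite !mxE permE mnmE /=.
  by congr (_ ^+ _); lia.
rewrite det_Vandermonde; apply: lregM; first exact/lreg_sign.
apply: (big_ind (@GRing.lreg _)) => [|p q|i _]; [exact: lreg1|exact: lregM|].
apply: (big_ind (@GRing.lreg _)) => [|p q|j lt_ij]; [exact: lreg1|exact: lregM|].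
rewrite !mxE; apply: lreg_mleadc; set p := _ - _.
have coef_p m : p@_m = (U_(j)%MM == m)%:R - (U_(i)%MM == m)%:R.
  by rewrite mcoeffB !mcoeffX.
have ne_ij : (U_(j)%MM == U_(i)%MM :> 'X_{1..k}) = false.
  by rewrite eq_mnm1 -val_eqE /= gtn_eqF.
have : mleadc p != 0.
  rewrite mleadc_eq0; apply/eqP => /(congr1 (mcoeff U_(i))) /eqP.
  by rewrite coef_p mcoeff0 eqxx ne_ij sub0r oppr_eq0 oner_eq0.
rewrite coef_p; have [E1|_] := eqVneq U_(j)%MM (mlead p);
  have [E2|_] := eqVneq U_(i)%MM (mlead p).
- by rewrite E1 E2 eqxx in ne_ij.
- by rewrite subr0 => _; exact: lreg1.
- by rewrite sub0r => _; apply: lregN; exact: lreg1.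
- by rewrite subrr eqxx.
Qed.

End Alternants.

(** * Unitriangular families and standard monomials *)

Section StandardMonomials.
Variables (K : comNzRingType) (k : nat).
Implicit Types (p q : {mpoly K[k]}) (m : 'X_{1..k}).

Lemma msizeM_leq p q d e :
  (msize p <= d.+1 -> msize q <= e -> msize (p * q) <= d + e)%N.
Proof.
move=> hp hq.
have [->|nz_p] := eqVneq p 0; first by rewrite mul0r msize0.
have [->|nz_q] := eqVneq q 0; first by rewrite mulr0 msize0.
have [->|nz_pq] := eqVneq (p * q) 0; first by rewrite msize0.
move: hp hq; rewrite -!mlead_deg // !ltnS => hp hq.
have := lemc_mdeg (mleadM_le p q); rewrite mdegD => h.
by rewrite (leq_ltn_trans h) // -addnS leq_add.
Qed.

Section Triangular.
Variable B : 'X_{1..k} -> {mpoly K[k]}.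
Hypothesis leadB : forall m, mlead (B m) = m.
Hypothesis leadcB : forall m, (B m)@_m = 1.

Definition subst_monomials p := \sum_(m <- msupp p) p@_m *: B m.
Local Notation Psi := subst_monomials.

Lemma subst_monomials_wE d p : (msize p <= d)%N ->
  Psi p = \sum_(m : 'X_{1..k < d}) p@_m *: B m.
Proof.
move=> le_pd; rewrite /subst_monomials (big_mksub ('X_{1..k < d} : subFinType _)) /=.
- by rewrite big_rmcond //= => i /memN_msupp_eq0 ->; rewrite scale0r.
- exact: msupp_uniq.
- by move=> m /msize_mdeg_lt /leq_trans; apply.
Qed.

Lemma subst_monomialsD p q : Psi (p + q) = Psi p + Psi q.
Proof.
pose d := maxn (msize p) (msize q).
rewrite !(@subst_monomials_wE d) ?leq_maxl ?leq_maxr //; last exact: msizeD_le.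
by rewrite -big_split; apply: eq_bigr => m _; rewrite mcoeffD scalerDl.
Qed.

Lemma subst_monomialsZX c m : Psi (c *: 'X_[m]) = c *: B m.
Proof.
have [->|nz_c] := eqVneq c 0; first by rewrite !scale0r /subst_monomials msupp0 big_nil.
by rewrite /subst_monomials msuppMCX // big_seq1 mcoeffZ mcoeffX eqxx mulr1.
Qed.

Lemma subst_monomials_lead p : (Psi p)@_(mlead p) = p@_(mlead p).
Proof.
have [->|nz_p] := eqVneq p 0; first by rewrite /subst_monomials msupp0 big_nil.
rewrite /subst_monomials raddf_sum (bigD1_seq (mlead p)) ?mlead_supp //=.
rewrite mcoeffZ leadcB mulr1 big_seq_cond big1 ?addr0 // => m /andP[m_in ne_m].
have lt_m : (m < mlead p)%O by rewrite lt_neqAle ne_m msupp_le_mlead.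
by rewrite mcoeffZ (mcoeff_gt_mlead (p := B m)) ?mulr0 ?leadB.
Qed.

(** Cancel the leading term of [q] with a multiple of [B (mlead q)], whose leading coefficient is 1,
    and recurse on the leading monomial. *)
Lemma subst_monomials_surj q : exists p, q = Psi p.
Proof.
elim/(@mleadrect k K): q => q IH.
have [->|nz_q] := eqVneq q 0; first by exists 0; rewrite /subst_monomials msupp0 big_nil.
pose q' := q - mleadc q *: B (mlead q).
suff [p Ep] : exists p, q' = Psi p.
  exists (p + mleadc q *: 'X_[mlead q]).
  by rewrite subst_monomialsD subst_monomialsZX -Ep subrK.
have [->|nz_q'] := eqVneq q' 0; first by exists 0; rewrite /subst_monomials msupp0 big_nil.
apply: IH; rewrite lt_neqAle; apply/andP; split.
  apply/eqP => E; have := mleadc_eq0 q'; rewrite (negPf nz_q') E.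
  by rewrite /q' mcoeffB mcoeffZ leadcB mulr1 subrr eqxx.
apply: le_trans (mleadB_le _ _) _; rewrite leUx lexx /=.
by apply: le_trans (mleadZ_le _ _) _; rewrite leadB.
Qed.

End Triangular.

Variables (g : 'I_k -> {mpoly K[k]}) (d : 'I_k -> nat).
Hypothesis d_gt0 : forall j, (0 < d j)%N.
Hypothesis leadg : forall j, mlead (g j) = (U_(j) *+ d j)%MM.
Hypothesis leadcg : forall j, mleadc (g j) = 1.

(* Euclidean division of the exponents by d turns the powers of the g_j and
   the standard monomials into a unitriangular K-basis indexed by all
   monomials. *)
Let B m : {mpoly K[k]} :=
  (\prod_j g j ^+ (m j %/ d j)) * 'X_[[multinom (m j %% d j)%N | j < k]].

Let expo m : (\sum_j mlead (g j ^+ (m j %/ d j)) +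
  [multinom (m j %% d j)%N | j < k] = m)%MM.
Proof.
apply/mnmP => i; rewrite mnmDE mnm_sumE mnmE.
rewrite (bigD1 i) //= big1 => [|j ne_ji].
  rewrite mleadX_proper ?leadcg ?leadg; last exact: lreg1.
  by rewrite !mulmnE mnm1E eqxx mul1n addn0 mulnC -divn_eq.
rewrite mleadX_proper ?leadcg ?leadg; last exact: lreg1.
by rewrite !mulmnE mnm1E (negPf ne_ji).
Qed.

Let leadprod m : mlead (\prod_j g j ^+ (m j %/ d j)) =
  (\sum_j mlead (g j ^+ (m j %/ d j)))%MM /\
  mleadc (\prod_j g j ^+ (m j %/ d j)) = 1.
Proof.
have h j : mleadc (g j ^+ (m j %/ d j)) = 1.
  by rewrite mleadcX_proper leadcg ?expr1n //; exact: lreg1.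
rewrite mlead_prod_proper => [|j _ _]; last by rewrite h; exact: lreg1.
by split=> //; rewrite mleadc_prod big1.
Qed.

Let leadB m : mlead (B m) = m.
Proof.
have [h1 h2] := leadprod m.
rewrite /B mleadM_proper ?h1 ?mleadXm ?expo // -h1 h2.
by rewrite mcoeffX eqxx mulr1 oner_neq0.
Qed.

Let leadcB m : (B m)@_m = 1.
Proof.
have [h1 h2] := leadprod m.
have := mleadcM (\prod_j g j ^+ (m j %/ d j)) 'X_[[multinom (m j %% d j)%N | j < k]].
by rewrite mleadXm h2 mcoeffX eqxx mulr1 h1 expo.
Qed.

(** Adding [d j] to exponent j raises its quotient by one and keeps all remainders. *)
Let B_shift j m : g j * B m = B (m + U_(j) *+ d j)%MM.
Proof.
rewrite /B mulrA; congr (_ * 'X_[_]); last first.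
  apply/mnmP => i; rewrite !mnmE mulmnE mnm1E.
  by case: eqP => [->|_]; rewrite ?mul0n ?addn0 // mul1n modnDr.
rewrite [LHS]mulrC (bigD1 j) //= [RHS](bigD1 j) //= mnmDE mulmnE mnm1E eqxx.
rewrite mul1n divnDr // divnn d_gt0 addn1 exprSr -!mulrA; congr (_ * _).
rewrite mulrC; congr (_ * _); apply: eq_bigr => i ne_ij.
by rewrite mnmDE mulmnE mnm1E eq_sym (negPf ne_ij) mul0n addn0.
Qed.

Local Notation Psi := (subst_monomials B).

(** Expanding each [q j] in the family [B] and multiplying by [g j] shifts the indices by [d j] in
    position j, so [F] is the image of a polynomial [p] with nonstandard monomials only. If [p] were
    nonzero, its leading monomial would occur in [F]. *)
Lemma ideal_standard_eq0 (q : 'I_k -> {mpoly K[k]}) (F : {mpoly K[k]}) :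
    F = \sum_j q j * g j ->
    (forall m, F@_m != 0 -> forall j, (m j < d j)%N) ->
  F = 0.
Proof.
move=> EF stdF.
have [p [nstd_p Ep]] : exists p,
    (forall m, p@_m != 0 -> exists j, (d j <= m j)%N) /\ F = Psi p.
  rewrite {stdF} EF; elim/big_ind: _ => [|_ _ [p1 [n1 ->]] [p2 [n2 ->]]|j _].
  - exists 0; split; last by rewrite /subst_monomials msupp0 big_nil.
    by move=> m; rewrite mcoeff0 eqxx.
  - exists (p1 + p2); rewrite subst_monomialsD; split=> // m.
    rewrite mcoeffD; have [->|/n1 //] := eqVneq p1@_m 0.
    by rewrite add0r; exact: n2.
  have [p ->] := subst_monomials_surj leadB leadcB (q j).
  exists (p * 'X_[(U_(j) *+ d j)%MM]); split.
    move=> m; rewrite -mcoeff_msupp (perm_mem (msuppMX _ _)).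
    case/mapP => m' _ ->; exists j.
    by rewrite mnmDE mulmnE mnm1E eqxx mul1n leq_addr.
  rewrite {2}/subst_monomials (perm_big _ (msuppMX _ _)) /= big_map mulr_suml.
  apply: eq_bigr => m _.
  by rewrite addmC [in RHS]addmC mcoeffMX -scalerAl mulrC B_shift addmC.
have [p0|nz_p] := eqVneq p 0; first by rewrite Ep p0 /subst_monomials msupp0 big_nil.
have nz : p@_(mlead p) != 0 by rewrite mleadc_eq0.
have [j] := nstd_p _ nz; rewrite leqNgt => /negP []; apply: stdF.
by rewrite Ep subst_monomials_lead.
Qed.

End StandardMonomials.

(** * Submodules and linear combinations *)

Section Combinations.
Variables (K : comNzRingType) (M : lmodType K).

Definition submodule_pred (C : M -> Prop) :=
  C 0 /\ forall c x y, C x -> C y -> C (c *: x + y).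

Lemma submodule_predZ C c x : submodule_pred C -> C x -> C (c *: x).
Proof. by move=> [C0 CP] Cx; rewrite -[_ *: _]addr0; apply: CP. Qed.

Lemma submodule_predD C x y : submodule_pred C -> C x -> C y -> C (x + y).
Proof. by move=> [_ CP] Cx Cy; rewrite -[x]scale1r; apply: CP. Qed.

Lemma submodule_pred_sum C (I : Type) (r : seq I) (P : pred I) (F : I -> M) :
    submodule_pred C -> (forall i, P i -> C (F i)) ->
  C (\sum_(i <- r | P i) F i).
Proof.
move=> subC CF; elim/big_ind: _ => // [|x y]; first by case: subC.
exact: submodule_predD.
Qed.

Variables (J : Type) (b : J -> M).

Definition combination (x : M) : Prop :=
  exists (m : nat) (f : 'I_m -> J) (c : 'I_m -> K),
    x = \sum_(i < m) c i *: b (f i).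

Lemma combination_submodule : submodule_pred combination.
Proof.
split=> [|c x y [m [f [e ->]]] [m' [f' [e' ->]]]].
  exists 0%N, (fun i : 'I_0 => False_rect J (notF (ltn_ord i))).
  by exists (fun=> 0); rewrite big_ord0.
exists (m + m')%N.
exists (fun i => match split i with inl j => f j | inr j => f' j end).
exists (fun i => match split i with inl j => c * e j | inr j => e' j end).
rewrite big_split_ord scaler_sumr /=; congr (_ + _); apply: eq_bigr => i _.
  by rewrite -[lshift _ _]/(unsplit (inl i)) unsplitK scalerA.
by rewrite -[rshift _ _]/(unsplit (inr i)) unsplitK.
Qed.

Lemma combination_gen j : combination (b j).
Proof. by exists 1%N, (fun=> j), (fun=> 1); rewrite big_ord1 scale1r. Qed.

End Combinations.

(** * Division of alternants by the Vandermonde alternant *)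

Lemma nth_filter_neq0 (s : seq nat) i : sorted geq s ->
  nth 0%N [seq x <- s | x != 0%N] i = nth 0%N s i.
Proof.
elim: s i => [//|[|x] s IH] i /= s_sorted; last first.
  by case: i => [//|i] /=; apply: IH; exact: path_sorted s_sorted.
have s0 : all (pred1 0%N) s.
  have tr : transitive geq by move=> a b c /= h1 h2; exact: leq_trans h2 h1.
  move: s_sorted; rewrite path_sortedE // => /andP[h _].
  by apply: sub_all h => a /=; rewrite leqn0.
have /eqP -> : [seq x <- s | x != 0%N] == [::].
  rewrite -size_eq0 size_filter -leqn0 leqNgt -has_count -all_predC.
  by apply: sub_all s0 => a /= ->.
rewrite nth_nil; case: i => [//|i] /=; have [lt_i|ge_i] := ltnP i (size s).
  by apply/esym/eqP; exact: (all_nthP 0%N s0).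
by rewrite nth_default.
Qed.

(** Sorting distinct exponents gives a strictly decreasing sequence; subtracting the staircase
    leaves a weakly decreasing one, whose nonzero entries are the parts. *)
Lemma sort_exponents k (m : 'X_{1..k}) : injective m ->
  exists (s : 'S_k) (la : intpart), (size la <= k)%N /\
    [multinom m (s i) | i < k] = (staircase k + part_mnm k la)%MM.
Proof.
move=> m_inj; pose t := [tuple m i | i < k].
have /tuple_permP [s Es] : perm_eq (sort geq t) t by rewrite perm_sort.
have t_uniq : uniq (sort geq t).
  by rewrite sort_uniq map_inj_uniq ?enum_uniq.
have t_sorted : sorted geq (sort geq t).
  by apply: sort_sorted => x y; rewrite /= leq_total.
have size_t : size (sort geq t) = k by rewrite size_sort size_tuple.
pose v i := nth 0%N (sort geq t) i.
have vE (i : 'I_k) : v i = m (s i).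
  by rewrite /v Es -tnth_nth !tnth_mktuple.
have geq_trans : transitive geq by move=> a b c /= h1 h2; exact: leq_trans h2 h1.
have v_dec i : (i.+1 < k)%N -> (v i.+1 < v i)%N.
  move=> lt_i; rewrite ltn_neqAle; apply/andP; split.
    by rewrite nth_uniq ?size_t ?(ltnW lt_i) // gtn_eqF.
  by apply: (sorted_ltn_nth geq_trans 0%N t_sorted); rewrite ?inE ?size_t // ltnW.
(* With [r = k.-1 - i] this shows that the truncated subtraction in [la0] is exact. *)
have v_le i r : (i + r < k)%N -> (v (i + r)%N + r <= v i)%N.
  elim: r => [|r IH]; first by rewrite !addn0.
  rewrite addnS => lt_r; have := IH (ltnW lt_r); have := v_dec _ lt_r; lia.
pose la0 := mkseq (fun i => v i - (k.-1 - i))%N k.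
have la0_sorted : sorted geq la0.
  apply/(sortedP 0%N) => i; rewrite size_mkseq => lt_i.
  rewrite !nth_mkseq ?(ltnW lt_i) //=; have := v_dec _ lt_i; lia.
have la_part : is_part [seq x <- la0 | x != 0%N].
  by rewrite /is_part sorted_filter // mem_filter eqxx.
exists s, (IntPart la_part); split.
  by rewrite /= size_filter -[leqRHS](size_mkseq (fun i => v i - (k.-1 - i))%N) count_size.
apply/mnmP => i; rewrite mnmDE !mnmE /= nth_filter_neq0 // nth_mkseq // -vE.
have := ltn_ord i; have := v_le i (k.-1 - i)%N; lia.
Qed.

Section AlternantDivision.
Variables (K : comNzRingType) (k : nat).
Implicit Types (p q : {mpoly K[k]}) (m : 'X_{1..k}) (f : sympoly K k).

Local Notation vdm := (antisym 'X_[staircase k] : {mpoly K[k]}).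

Lemma sympoly_symmetric f : val f \is symmetric.
Proof. exact: valP. Qed.

Definition vdm_quotient (C : sympoly K k -> Prop) p : Prop :=
  exists2 f : sympoly K k, p = vdm * val f & C f.

Lemma vdm_quotient_submodule C :
  submodule_pred C -> submodule_pred (vdm_quotient C).
Proof.
move=> [C0 CP]; split; first by exists 0; rewrite ?mulr0.
move=> c _ _ [f -> Cf] [g -> Cg]; exists (c *: f + g); last exact: CP.
by rewrite scalerAr -mulrDr.
Qed.

Definition box_combination n : sympoly K k -> Prop :=
  combination (fun la : {la : intpart | Pkn k n la} => schurS K k (val la)).

Let bounded n d f := (msize (val f) <= d)%N /\ box_combination n f.

Lemma size_bound_submodule d :
  submodule_pred (fun f : sympoly K k => msize (val f) <= d)%N.
Proof.
split=> [|c f g le_f le_g]; first by rewrite msize0.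
apply: leq_trans (msizeD_le _ _) _; rewrite geq_max le_g andbT.
exact: leq_trans (msizeZ_le _ _) le_f.
Qed.

Lemma bounded_box_submodule n d : submodule_pred (bounded n d).
Proof.
have [s0 sP] := size_bound_submodule d.
have [b0 bP] := combination_submodule
  (fun la : {la : intpart | Pkn k n la} => schurS K k (val la)).
split=> // c f g [sf bf] [sg bg].
by split; [exact: sP | exact: bP].
Qed.

Lemma msize_schur (la : intpart) : (size la <= k)%N ->
  (msize (schur K k la) <= (mdeg (part_mnm k la)).+1)%N.
Proof.
move=> le_k; rewrite msizeE; apply/bigmax_leqP_seq => m.
rewrite mcoeff_msupp => /schur_supp [T ssT <-] _.
by rewrite (mdeg_weight_ssyt le_k).
Qed.

Lemma antisym_schur (la : intpart) :
  vdm * schur K k la =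
  \sum_(T : {ffun cell la -> 'I_k} | ssyt T) antisym 'X_[staircase k + weight T].
Proof.
rewrite -antisym_symM ?schur_sym // schur_weightE mulr_sumr raddf_sum /=.
by apply: eq_bigr => T _; rewrite mpolyXD.
Qed.

(* The induction is on the sum of the squares of the exponents, which does not
   depend on their order. *)
Lemma antisymX_box_quotient n m : (k <= n)%N -> (forall i, (m i < n)%N) ->
  vdm_quotient (bounded n ((mdeg m).+1 - mdeg (staircase k))) (antisym 'X_[m]).
Proof.
move=> le_kn; have [r] := ubnP (\sum_i m i ^ 2)%N; elim: r m => // r IH m lt_r lt_m.
set d := (_ - _)%N; have subC := vdm_quotient_submodule (bounded_box_submodule n d).
have [/existsP [i /existsP [j /andP[ne_ij /eqP Em]]]|] :=
  boolP [exists i, exists j, (i != j) && (m i == m j)].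
  by rewrite (antisymX_eq0 K ne_ij Em); case: subC.
rewrite negb_exists => /forallP m_inj.
have {}m_inj : injective m.
  move=> i j E; apply/eqP; have := m_inj i; rewrite negb_exists => /forallP/(_ j).
  by rewrite E eqxx andbT negbK.
have [s [la [le_k Es]]] := sort_exponents m_inj.
have -> : antisym 'X_[K, m] =
    (-1) ^+ s *: antisym 'X_[(staircase k + part_mnm k la)%MM].
  by rewrite -Es antisymX_perm scalerA -signr_addb addbb scale1r.
apply: submodule_predZ => //.
have mE i : m (s i) = (k.-1 - i + nth 0 la i)%N.
  by have := congr1 (fun u : 'X_{1..k} => u i) Es; rewrite !mnmE.
have mdegE' : mdeg m = (mdeg (staircase k) + mdeg (part_mnm k la))%N.
  by rewrite -mdegD -Es mdeg_mperm.
(* The first part is the largest exponent minus k-1, hence at most n-k. *)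
have box_la : Pkn k n la.
  rewrite /Pkn le_k; apply/(all_nthP 0%N) => i lt_i.
  apply: leq_trans (part_nth_le la (leq0n i)) _.
  have k_gt0 : (0 < k)%N by lia.
  by have := mE (Ordinal k_gt0); have := lt_m (s (Ordinal k_gt0)); rewrite /=; lia.
have -> : antisym 'X_[(staircase k + part_mnm k la)%MM] =
    vdm * schur K k la + (-1) *:
    \sum_(T : {ffun cell la -> 'I_k} | ssyt T && (T != row_tableau le_k))
       antisym 'X_[(staircase k + weight T)%MM].
  rewrite scaleN1r antisym_schur (bigD1 (row_tableau le_k)) ?row_tableau_ssyt //=.
  by rewrite weight_row_tableau addrK.
apply: submodule_predD => //.
  exists (schurS K k la) => //; split.
    apply: leq_trans (msize_schur le_k) _.
    by rewrite /d mdegE' -addnS addKn.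
  exact: (combination_gen (fun la : {la : intpart | Pkn k n la} =>
    schurS K k (val la)) (exist _ la box_la)).
apply: submodule_predZ => //; apply: submodule_pred_sum => // T /andP[ssT neT].
have -> : d = ((mdeg (staircase k + weight T)).+1 - mdeg (staircase k))%N.
  by rewrite /d mdegE' mdegD (mdeg_weight_ssyt le_k).
(* Staircase entries are at most k-1 and weights at most n-k, so the exponents stay below n. *)
apply: IH => [|i]; last first.
  rewrite mnmDE mnmE; have lt_i := ltn_ord i; have := weight_le_row i ssT.
  have [lt0|ge0] := ltnP 0 (size la); last by rewrite nth_default //; lia.
  have /andP[_ /(all_nthP 0%N)/(_ 0%N lt0)] := box_la.
  by move=> /=; lia.
rewrite -ltnS; apply: leq_trans lt_r; rewrite ltnS.
rewrite [X in (_ < X)%N](reindex_inj (@perm_inj _ s)) /=.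
(* The staircase entry is k-1-i, so for a fixed degree of [w] the left-hand sum of squares depends
   on the squares of [w], which do not grow, minus twice the sum of the [i * w i], which grows
   strictly. *)
have sqr_expand (w : 'X_{1..k}) : (\sum_i (staircase k + w)%MM i ^ 2 +
    (\sum_(i < k) i * w i).*2 =
  \sum_i staircase k i ^ 2 + \sum_i w i ^ 2 + (k.-1 * mdeg w).*2)%N.
  rewrite mdegE -!mul2n !big_distrr -!big_split /=; apply: eq_bigr => i _.
  rewrite mnmDE mnmE; have := ltn_ord i; nia.
have Erow : (\sum_i m (s i) ^ 2 = \sum_i (staircase k + part_mnm k la)%MM i ^ 2)%N.
  by apply: eq_bigr => i _; rewrite -Es mnmE.
have neT' : weight T != part_mnm k la by rewrite weight_eq_part.
have aux (a b p q x y c d' : nat) : (a <= b -> p < q ->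
  y + p.*2 = d' + b + c -> x + q.*2 = d' + a + c -> x < y)%N by lia.
rewrite Erow; apply: (aux _ _ _ _ _ _ (k.-1 * mdeg (part_mnm k la)).*2 _
  (weight_sqr_le le_k ssT) (weight_cost le_k ssT neT') (sqr_expand _)).
by rewrite sqr_expand (mdeg_weight_ssyt le_k).
Qed.

End AlternantDivision.

(** * Elimination of variables from complete homogeneous polynomials *)

Section Elimination.
Variables (K : comNzRingType) (k : nat).
Implicit Types (u v : nat -> {mpoly K[k]}) (w : 'X_{1..k}).

(* 'X_j for j < k, and the junk value 0 otherwise. *)
Definition nat_var (j : nat) : {mpoly K[k]} := oapp (fun i : 'I_k => 'X_i) 0 (insub j).

(* Applied to u m = h_m(x_0, ..., x_{k-1}), this yields
   h_m(x_j, ..., x_{k-1}). *)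
Fixpoint eliminate (j : nat) u (m : nat) : {mpoly K[k]} :=
  if j is j'.+1 then eliminate j' u m - nat_var j' * eliminate j' u m.-1 else u m.

Lemma nat_var_ord (i : 'I_k) : nat_var i = 'X_i.
Proof. by rewrite /nat_var valK. Qed.

Lemma eliminateB j u v m :
  eliminate j (fun i => u i - v i) m = eliminate j u m - eliminate j v m.
Proof.
elim: j m => [//|j IH] m /=; rewrite !IH mulrBr !opprB.
by rewrite addrACA [RHS]addrACA; congr (_ + _); rewrite addrC.
Qed.

Lemma msize_nat_var j : (msize (nat_var j) <= 2)%N.
Proof.
by rewrite /nat_var; case: insubP => [i _ _|_] /=; rewrite ?msizeX ?mdeg1 ?msize0.
Qed.

Lemma msize_eliminate N j u m :
    (forall i, (N < i)%N -> (msize (u i) <= i)%N) ->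
  (N + j < m)%N -> (msize (eliminate j u m) <= m)%N.
Proof.
move=> size_u; elim: j m => [|j IH] m lt_m /=; first by apply: size_u; lia.
apply: leq_trans (msizeD_le _ _) _; rewrite geq_max IH ?msizeN /=; last by lia.
have := msizeM_leq (msize_nat_var j) (IH m.-1 _).
by move=> h; apply: leq_trans (h _) _; lia.
Qed.

(** The monomials of h_m(x_j, ..., x_{k-1}) divisible by x_j are x_j times those of h_{m-1}(x_j,
    ..., x_{k-1}); subtracting them removes x_j. With [j <= m] the predecessor never truncates. *)
Lemma eliminate_hsym j m w : (j <= k)%N -> (j <= m)%N ->
  (eliminate j (hsym K k) m)@_w =
  ((mdeg w == m) && [forall i : 'I_k, (i < j)%N ==> (w i == 0%N)])%:R.
Proof.
elim: j m w => [|j IH] m w le_jk le_jm /=.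
  rewrite mcoeff_hsym; have -> : [forall i : 'I_k, (i < 0)%N ==> (w i == 0%N)].
    by apply/forallP.
  by rewrite andbT.
pose x := Ordinal le_jk; rewrite -[j]/(nat_of_ord x) nat_var_ord /= mulrC.
rewrite mcoeffB IH ?(ltnW le_jk) ?(ltnW le_jm) //.
have split_j (w1 : 'X_{1..k}) : [forall i : 'I_k, (i < j.+1)%N ==> (w1 i == 0%N)] =
    (w1 x == 0%N) && [forall i : 'I_k, (i < j)%N ==> (w1 i == 0%N)].
  apply/forallP/andP => [h|[/eqP h0 /forallP h] i].
    split; first by have := h x; rewrite ltnSn.
    by apply/forallP => i; apply/implyP => lt_i; have := h i; rewrite ltnW.
  rewrite ltnS leq_eqVlt; apply/implyP => /orP[/eqP E|].
    by have -> : i = x; [exact: val_inj | rewrite h0].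
  exact/implyP/h.
rewrite split_j; have [w0|w_gt0] := posnP (w x).
  rewrite /= memN_msupp_eq0 ?subr0 // (perm_mem (msuppMX _ _)).
  apply/mapP => -[w' _ E]; move: w0.
  by rewrite E mnmDE mnm1E eqxx.
rewrite andbF.
have le_x : (U_(x) <= w)%MM by rewrite lep1mP -lt0n.
rewrite -(submK le_x) addmC mcoeffMX IH ?(ltnW le_jk) //; last by lia.
rewrite mdegD mdeg1 add1n.
have -> : [forall i : 'I_k, (i < j)%N ==> ((U_(x) + (w - U_(x)))%MM i == 0%N)] =
    [forall i : 'I_k, (i < j)%N ==> ((w - U_(x))%MM i == 0%N)].
  apply: eq_forallb => i; case: ltnP => //= lt_i.
  by rewrite mnmDE mnm1E -val_eqE /= (gtn_eqF lt_i).
have -> : ((mdeg (w - U_(x))%MM).+1 == m) = (mdeg (w - U_(x))%MM == m.-1) by lia.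
by rewrite subrr.
Qed.

(** Up to terms of lower degree, the result is the complete homogeneous polynomial in x_j, ...,
    x_{k-1}, whose largest monomial is the pure power of x_j. *)
Lemma eliminate_lead N (j : nat) u : (forall i, (N < i)%N -> (msize (hsym K k i - u i) <= i)%N) ->
  forall i : 'I_k, j = i ->
  mlead (eliminate j u (N + j).+1) = (U_(i) *+ (N + j).+1)%MM /\
  (eliminate j u (N + j).+1)@_(U_(i) *+ (N + j).+1)%MM = 1.
Proof.
move=> size_a i Ej; set m := (N + j).+1; set p := eliminate j u m.
pose a m := hsym K k m - u m.
have Ep w : (m <= mdeg w)%N ->
    p@_w = ((mdeg w == m) && [forall i : 'I_k, (i < j)%N ==> (w i == 0%N)])%:R.
  move=> le_w; rewrite -eliminate_hsym; [|by rewrite Ej ltnW|by rewrite /m; lia].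
  apply/eqP; rewrite eq_sym -subr_eq0 -mcoeffB -eliminateB mcoeff_eq0.
  apply: msize_mdeg_ge; apply: leq_trans le_w.
  by apply: (msize_eliminate (N := N)).
have deg0 : mdeg (U_(i) *+ m) = m by rewrite mdegMn mdeg1 mul1n.
have p1 : p@_(U_(i) *+ m)%MM = 1.
  rewrite Ep deg0 // eqxx /=; case: forallP => // -[] i'.
  by rewrite mulmnE mnm1E -val_eqE /= -Ej; case: ltngtP.
split=> //; apply/le_anti/andP; split; last first.
  by apply: msupp_le_mlead; rewrite mcoeff_msupp p1 oner_neq0.
have p_neq0 : p != 0.
  by apply: contra_eqN p1 => /eqP ->; rewrite mcoeff0 eq_sym oner_neq0.
move: (mlead p) (mlead_supp p_neq0) => w; rewrite mcoeff_msupp => nz_w.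
have [lt_w|ge_w] := ltnP (mdeg w) m.
  by apply/ltW/lt_mdeg_ltmc; rewrite deg0.
move: nz_w; rewrite Ep //; case: andP => [[/eqP Ew /forallP w0] _|]; last first.
  by rewrite eqxx.
rewrite le_eqVlt; have [//|ne_w] := eqVneq w _; apply/ltmcP; first by rewrite deg0.
exists i => [l lt_l|].
  have := w0 l; rewrite Ej lt_l => /eqP ->.
  by rewrite mulmnE mnm1E -val_eqE /= gtn_eqF.
rewrite mulmnE mnm1E eqxx mul1n ltn_neqAle -{2}Ew mdegE (bigD1 i) //= leq_addr andbT.
apply: contra ne_w => /eqP Ei; apply/eqP/mnmP => l.
rewrite mulmnE mnm1E; have [<-|ne_l] := eqVneq i l; first by rewrite mul1n.
move: Ew; rewrite mdegE (bigD1 i) //= Ei -{2}[m]addn0 => /addnI.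
by rewrite (bigD1 l) 1?eq_sym //=; lia.
Qed.

(** The recursion expresses [eliminate j u m] by [eliminate j.+1 u m] and [eliminate j u m.-1]. Both
    are closer to the diagonal m = N+j+1, whose members are the generators. *)
Lemma eliminate_generates N u j m : (N + j < m)%N -> (m <= N + k)%N ->
  exists q : 'I_k -> {mpoly K[k]},
    eliminate j u m = \sum_(i < k) q i * eliminate i u (N + i).+1.
Proof.
move Er: (m - (N + j).+1)%N => r; elim: r j m Er => [|r IH] j m Er lt_m le_m.
  have lt_j : (j < k)%N by lia.
  exists (fun i => (i == Ordinal lt_j)%:R); rewrite (bigD1 (Ordinal lt_j)) //=.
  rewrite eqxx mul1r big1 ?addr0 => [|i /negPf ->]; last by rewrite mul0r.
  by congr eliminate; lia.
have [q1 E1] := IH j.+1 m ltac:(lia) ltac:(lia) ltac:(lia).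
have [q2 E2] := IH j m.-1 ltac:(lia) ltac:(lia) ltac:(lia).
exists (fun i => q1 i + nat_var j * q2 i).
have -> : eliminate j u m = eliminate j.+1 u m + nat_var j * eliminate j u m.-1.
  by rewrite /= subrK.
rewrite E1 E2 mulr_sumr -big_split; apply: eq_bigr => i _ /=.
by rewrite mulrDl mulrA.
Qed.

(** The coefficients constructed are those of the product of the factors 1 - x_l t for l < j, that
    is, signed elementary symmetric polynomials. *)
Lemma eliminate_expand j : exists c : nat -> {mpoly K[k]},
  [/\ forall i, (msize (c i) <= i.+1)%N, forall i, (j < i)%N -> c i = 0 &
    forall u m, (j <= m)%N -> eliminate j u m = \sum_(i < j.+1) c i * u (m - i)%N].
Proof.
elim: j => [|j [c [size_c c0 cE]]].
  exists (fun i => (i == 0%N)%:R); split=> [[|i]|[|i]|u m _] //=.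
  - by rewrite msize1.
  - by rewrite msize0.
  - by rewrite big_ord1 eqxx mul1r subn0.
exists (fun i => c i - (if i is i'.+1 then nat_var j * c i' else 0)); split.
- move=> i; apply: leq_trans (msizeD_le _ _) _; rewrite geq_max size_c msizeN /=.
  by case: i => [|i]; rewrite ?msize0 //; apply: msizeM_leq (msize_nat_var j) _.
- by move=> [//|i] lt_i; rewrite !c0 ?mulr0 ?subr0 //; lia.
move=> u m le_m /=; rewrite !cE; [|lia|lia].
under [RHS]eq_bigr => i _ do rewrite mulrBl.
rewrite sumrB [in RHS]big_ord_recr /= c0 // mul0r addr0; congr (_ - _).
rewrite [RHS]big_ord_recl /= mul0r add0r mulr_sumr; apply: eq_bigr => i _ /=.
by rewrite mulrA; congr (_ * u _); rewrite /bump /=; lia.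
Qed.

(** Eliminating all variables but the last from h_n leaves a pure power, and expanding the
    elimination involves only h_{n-k+1}, ..., h_n. *)
Lemma last_var_pow n (l : 'I_k) : (k <= n)%N -> l.+1 = k ->
  exists q : 'I_k -> {mpoly K[k]}, (forall i : 'I_k, (msize (q i) <= k - i)%N) /\
    'X_[U_(l) *+ n] = \sum_(i < k) q i * hsym K k (n - k + i.+1)%N.
Proof.
move=> le_kn El; have [c [size_c _ cE]] := eliminate_expand k.-1.
exists (fun i : 'I_k => c (k.-1 - i)%N); split=> [i|].
  by apply: leq_trans (size_c _) _; have := ltn_ord i; lia.
have -> : 'X_[U_(l) *+ n] = eliminate k.-1 (hsym K k) n.
  apply/mpolyP => w; rewrite mcoeffX eliminate_hsym; [|lia|lia].
  congr (_ : bool)%:R; apply/eqP/andP => [<-|[/eqP Ew /forallP w0]].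
    rewrite mdegMn mdeg1 mul1n eqxx; split=> //; apply/forallP => i.
    apply/implyP => lt_i; have lt_l : (i < l)%N by lia.
    by rewrite mulmnE mnm1E -val_eqE /= (gtn_eqF lt_l).
  have w0' i : i != l -> w i = 0%N.
    move=> ne_i; apply/eqP; apply: (implyP (w0 i)).
    have := ltn_ord i; move: ne_i; rewrite -val_eqE /=; lia.
  apply/mnmP => i; rewrite mulmnE mnm1E -Ew mdegE (bigD1 l) //= big1 => [|i' /w0' //].
  by rewrite addn0; have [<-|/w0' ->] := eqVneq i l; rewrite ?eqxx ?mul1n.
rewrite cE; last by lia.
rewrite -(big_mkord xpredT (fun i => c i * hsym K k (n - i)%N)) /=.
rewrite prednK; last by lia.
rewrite big_mkord (reindex_inj rev_ord_inj) /=; apply: eq_bigr => i _.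
by have := ltn_ord i => lt_i; congr (c _ * hsym K k _); lia.
Qed.

End Elimination.

(** * Spanning modulo the ideal *)

Section Spanning.
Variables (K : comNzRingType) (k n : nat).
Hypothesis le_kn : (k <= n)%N.
Implicit Types (p : {mpoly K[k]}) (m : 'X_{1..k}) (f : sympoly K k).

Local Notation vdm := (antisym 'X_[staircase k] : {mpoly K[k]}).

Lemma vdm_quotientW (C D : sympoly K k -> Prop) p :
  vdm_quotient C p -> (forall f, C f -> D f) -> vdm_quotient D p.
Proof. by move=> [f -> Cf] CD; exists f => //; exact: CD. Qed.

Lemma antisym_quotient p d : (msize p <= d)%N ->
  vdm_quotient (fun f => (msize (val f) <= d - mdeg (staircase k))%N) (antisym p).
Proof.
move=> size_p; rewrite [p]mpolyE raddf_sum /= big_seq.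
have subC := vdm_quotient_submodule (size_bound_submodule K k (d - mdeg (staircase k))).
apply: submodule_pred_sum => // m m_p; rewrite linearZ; apply: submodule_predZ => //.
(* The box is chosen large enough for [m]; only the degree bound on the quotient is kept. *)
have le_m (i : 'I_k) : (m i < (maxn k (mdeg m)).+1)%N.
  by rewrite ltnS leq_max mdegE (bigD1 i) //= leq_addr orbT.
have Q := antisymX_box_quotient K (leqW (leq_maxl k (mdeg m))) le_m.
apply: (vdm_quotientW Q).
move=> f [size_f _]; apply: leq_trans size_f _; apply: leq_sub2r.
exact: leq_trans (msize_mdeg_lt m_p) size_p.
Qed.

(** The bounds force each product of [b i] with its h to have degree below [d - 1 + 1 = d], so
    replacing h by a polynomial of smaller degree makes progress. A truncated bound of 0 means
    [b i = 0]. *)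
Let reducible d f := exists (w : sympoly K k) (b : 'I_k -> sympoly K k),
  [/\ f = w + \sum_(i < k) b i * hS K k (n - k + i.+1)%N, box_combination n w &
    forall i, (msize (val (b i)) <= d - (n - k + i.+1))%N].

Lemma reducible_submodule d : submodule_pred (reducible d).
Proof.
have [w0 wP] := combination_submodule
  (fun la : {la : intpart | Pkn k n la} => schurS K k (val la)).
split=> [|c f g [w [b [-> box_w size_b]]] [w' [b' [-> box_w' size_b']]]].
  exists 0, (fun=> 0); split=> // [|i]; last by rewrite msize0.
  by rewrite add0r big1 // => i _; rewrite mul0r.
exists (c *: w + w'), (fun i => c *: b i + b' i); split=> [||i].
- rewrite scalerDr addrACA; congr (_ + _); rewrite scaler_sumr -big_split /=.
  by apply: eq_bigr => i _; rewrite mulrDl scalerAl.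
- exact: wP.
- by have [_ sP] := size_bound_submodule K k (d - (n - k + i.+1)); apply: sP.
Qed.

(** An exponent that is too large is moved to the last variable at the cost of a sign, and the n-th
    power of that variable is expanded in the h's. Being symmetric, these leave the
    antisymmetrization. *)
Lemma antisymX_reducible d m : (mdeg m < d + mdeg (staircase k))%N ->
  vdm_quotient (reducible d) (antisym 'X_[m]).
Proof.
move=> lt_m; have subC := vdm_quotient_submodule (reducible_submodule d).
have [/forallP lt_n|] := boolP [forall i : 'I_k, (m i < n)%N].
  apply: (vdm_quotientW (antisymX_box_quotient K le_kn lt_n)) => f [_ box_f].
  exists f, (fun=> 0); split=> // [|i]; last by rewrite msize0.
  by rewrite big1 ?addr0 // => i _; rewrite mul0r.
rewrite negb_forall => /existsP [i0]; rewrite -leqNgt => ge_n.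
have k_gt0 : (0 < k)%N by apply: leq_ltn_trans (ltn_ord i0).
have lt_l : (k.-1 < k)%N by rewrite prednK.
pose l := Ordinal lt_l; pose s := tperm i0 l.
pose m1 : 'X_{1..k} := [multinom m (s i) | i < k].
have -> : antisym 'X_[K, m] = (-1) ^+ s *: antisym 'X_[m1].
  by rewrite antisymX_perm scalerA -signr_addb addbb scale1r.
apply: submodule_predZ => //.
have le_m1 : (U_(l) *+ n <= m1)%MM.
  apply/mnm_lepP => i; rewrite mulmnE mnm1E mnmE.
  by have [<-|_] := eqVneq l i; rewrite ?mul1n ?tpermR ?mul0n.
have [q [size_q Eq]] := last_var_pow K le_kn (prednK k_gt0 : l.+1 = k).
pose m2 := (m1 - U_(l) *+ n)%MM.
have deg_m : mdeg m = (mdeg m2 + n)%N.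
  by rewrite -(mdeg_mperm m s) -/m1 -(submK le_m1) mdegD mdegMn mdeg1 mul1n.
have -> : antisym 'X_[K, m1] =
    \sum_(i < k) antisym (q i * 'X_[m2]) * hsym K k (n - k + i.+1)%N.
  rewrite -(submK le_m1) -/m2 addmC mpolyXD Eq mulr_suml raddf_sum /=.
  apply: eq_bigr => i _; rewrite -antisym_symM ?hsym_sym //.
  by congr antisym; rewrite mulrAC.
apply: submodule_pred_sum => // i _.
have size_qm : (msize (q i * 'X_[m2]) <= k - i.+1 + (mdeg m2).+1)%N.
  apply: msizeM_leq; last by rewrite msizeX.
  by apply: leq_trans (size_q i) _; have := ltn_ord i; lia.
have [g -> size_g] := antisym_quotient size_qm.
exists (g * hS K k (n - k + i.+1)%N); first by rewrite mulrA.
exists 0, (fun j => if j == i then g else 0); split=> [||j].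
- rewrite add0r (bigD1 i) //= eqxx big1 ?addr0 // => j /negPf ->.
  by rewrite mul0r.
- by case: (combination_submodule
    (fun la : {la : intpart | Pkn k n la} => schurS K k (val la))).
- case: eqP => [->|_]; last by rewrite msize0.
  by apply: leq_trans size_g _; have := ltn_ord i; lia.
Qed.

(** The product of [f] with the Vandermonde alternant is a combination of alternants, each already
    reducible; the regular factor is then cancelled. *)
Lemma sympoly_reducible d f : (msize (val f) <= d)%N -> reducible d f.
Proof.
move=> size_f.
have [g Eg red_g] : vdm_quotient (reducible d) (vdm * val f).
  rewrite -antisym_symM ?sympoly_symmetric // [X in 'X_[_] * X]mpolyE.
  rewrite mulr_sumr raddf_sum /= big_seq.
  have subC := vdm_quotient_submodule (reducible_submodule d).
  apply: submodule_pred_sum => // m m_f.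
  rewrite -scalerAr linearZ; apply: submodule_predZ => //.
  rewrite -mpolyXD; apply: antisymX_reducible.
  by rewrite mdegD addnC ltn_add2r; apply: leq_trans (msize_mdeg_lt m_f) _.
by move/(@antisym_staircase_lreg K k)/val_inj: Eg => ->.
Qed.

Variable a : 'I_k -> sympoly K k.
Hypothesis deg_a : forall i : 'I_k, deg_lt (a i) (n - k + i.+1)%N.

(** Writing b h as b (h - a) + b a splits off an element of the ideal; the sum of the b a has
    smaller degree and falls to induction. *)
Lemma sympoly_box_mod_ideal f :
  exists (w : sympoly K k) (b : 'I_k -> sympoly K k),
  f = w + \sum_(i < k) b i * (hS K k (n - k + i.+1)%N - a i) /\
  box_combination n w.
Proof.
have [box0 boxP] := combination_submodule
  (fun la : {la : intpart | Pkn k n la} => schurS K k (val la)).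
have [d] := ubnP (msize (val f)); elim: d f => // d IH f; rewrite ltnS => size_f.
have [f0|nz_f] := eqVneq f 0.
  exists 0, (fun=> 0); split=> //; rewrite f0 add0r big1 // => i _.
  by rewrite mul0r.
have d_gt0 : (0 < d)%N.
  apply: leq_trans size_f; rewrite lt0n mmeasure_poly_eq0.
  by apply: contra nz_f => /eqP f0; apply/eqP/val_inj.
have [w [b [Ef box_w size_b]]] := sympoly_reducible size_f.
have [|w' [b' [Ef' box_w']]] := IH (\sum_i b i * a i).
  rewrite -[d in (_ < d)%N]prednK // ltnS.
  apply: (@submodule_pred_sum K _ (fun f : sympoly K k => msize (val f) <= d.-1)%N) => [|i _].
    exact: size_bound_submodule.
  have := size_b i; case E: (d - _)%N => [|e] size_bi.
    have -> : b i = 0 by apply/val_inj/eqP; rewrite -msize_poly_eq0 -leqn0.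
    by rewrite mul0r msize0.
  apply: leq_trans (msizeM_leq size_bi (deg_a i)) _; lia.
exists (1 *: w + w'), (fun i => b i + b' i); split; last exact: boxP.
rewrite scale1r Ef -addrA; congr (_ + _).
under [in RHS]eq_bigr => i _ do rewrite mulrDl mulrBr.
rewrite big_split sumrB /= addrCA -Ef' subrK //.
Qed.

End Spanning.

(** * Linear independence modulo the ideal *)

Section Independence.
Variables (K : comNzRingType) (k n : nat).

(** As parts are nonzero, the exponent vector also determines their number. *)
Lemma part_mnm_inj (la mu : intpart) : (size la <= k)%N -> (size mu <= k)%N ->
  part_mnm k la = part_mnm k mu -> la = mu.
Proof.
have size_le (l1 l2 : intpart) : (size l1 <= k)%N ->
    part_mnm k l1 = part_mnm k l2 -> (size l1 <= size l2)%N.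
  move=> le_k E; rewrite leqNgt; apply/negP => lt_s.
  have := congr1 (fun w : 'X_{1..k} => w (Ordinal (leq_trans lt_s le_k))) E.
  rewrite !mnmE /= [RHS]nth_default // => E0.
  by case: l1 lt_s E0 {le_k E} => s /= /andP[_ /negP h] lt_s E0; case: h; rewrite -E0 mem_nth.
move=> le_la le_mu E; apply: val_inj; apply: (@eq_from_nth _ 0%N).
  by apply/eqP; rewrite eqn_leq !size_le.
move=> i lt_i.
have := congr1 (fun w : 'X_{1..k} => w (Ordinal (leq_trans lt_i le_la))) E.
by rewrite !mnmE.
Qed.

(** At the exponent vector of [la i], the Schur polynomial of [la i] has coefficient 1, and any
    other one that contributes has a smaller [cost]. Induction on [cost] therefore kills the
    coefficients one by one. *)
Lemma schur_independent r (la : 'I_r -> intpart) (c : 'I_r -> K) :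
    injective la -> (forall i, (size (la i) <= k)%N) ->
  \sum_i c i *: schur K k (la i) = 0 -> forall i, c i = 0.
Proof.
move=> la_inj le_k E0.
pose cost i := (\sum_(v < k) v * part_mnm k (la i) v)%N.
move=> i; have [e] := ubnP (cost i); elim: e i => // e IH i lt_e.
have := congr1 (mcoeff (part_mnm k (la i))) E0.
rewrite mcoeff0 raddf_sum (bigD1 i) //= mcoeffZ schur_part // mulr1.
rewrite big1 ?addr0 // => j ne_j; rewrite mcoeffZ.
have [->|/schur_supp [T ssT ET]] := eqVneq (schur K k (la j))@_(part_mnm k (la i)) 0.
  by rewrite mulr0.
rewrite IH ?mul0r //; apply: leq_trans (_ : cost i <= e)%N => //.
rewrite /cost -ET; apply: weight_cost => //; apply: contra ne_j => /eqP E.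
by apply/eqP/la_inj/part_mnm_inj => //; rewrite -E ET.
Qed.

Variable a : 'I_k -> sympoly K k.
Hypothesis deg_a : forall i : 'I_k, deg_lt (a i) (n - k + i.+1)%N.

(** Elimination expresses the generators through polynomials with leading monomials x_j^(n-k+j+1),
    none of which divides a monomial of [F]. *)
Lemma ideal_box_eq0 (b : 'I_k -> sympoly K k) (F : {mpoly K[k]}) :
    F = \sum_i val (b i) * val (hS K k (n - k + i.+1)%N - a i) ->
    (forall m, F@_m != 0 -> forall i : 'I_k, (m i <= n - k)%N) ->
  F = 0.
Proof.
move=> EF boxF; set N := (n - k)%N in EF boxF.
(* Reindexing by degree: [a i] sits at N+i+1, and degrees past N+k get 0. *)
pose a' m : {mpoly K[k]} := oapp (fun i : 'I_k => val (a i)) 0 (insub (m - N.+1)%N).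
pose u m := hsym K k m - a' m.
have a'E (i : 'I_k) : a' (N + i.+1)%N = val (a i).
  rewrite /a'; have -> : (N + i.+1 - N.+1 = i)%N by lia.
  by rewrite valK.
have size_a' m : (N < m)%N -> (msize (hsym K k m - u m) <= m)%N.
  move=> lt_m; rewrite /u opprB addrCA subrr addr0 /a'.
  case: insubP => [i _ Ei|_] /=; last by rewrite msize0.
  by apply: leq_trans (deg_a i) _; rewrite Ei; lia.
have lead_u (i : 'I_k) := eliminate_lead size_a' (erefl (nat_of_ord i)).
pose g (i : 'I_k) := eliminate i u (N + i).+1.
have gen (i : 'I_k) : exists q : 'I_k -> {mpoly K[k]},
    u (N + i.+1)%N = \sum_(j < k) q j * g j.
  have lt_i := ltn_ord i.
  by apply: (@eliminate_generates _ _ N u 0); lia.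
have [Q EQ] := fin_all_exists gen.
apply: (@ideal_standard_eq0 K k g (fun i : 'I_k => (N + i).+1) _ _ _
  (fun j => \sum_i val (b i) * Q i j)).
- by [].
- by move=> j; have [] := lead_u j.
- by move=> j; have [-> ] := lead_u j.
- under eq_bigr => j _ do rewrite mulr_suml.
  rewrite exchange_big EF /=; apply: eq_bigr => i _.
  transitivity (val (b i) * u (N + i.+1)%N); first by rewrite /u a'E.
  by rewrite EQ mulr_sumr; apply: eq_bigr => j _; rewrite mulrA.
- by move=> m nz_m j; have := boxF m nz_m j; lia.
Qed.

End Independence.

(* The index i : 'I_k below is one less than the index of a_1, ..., a_k. *)
Theorem theorem2p7 (K : comNzRingType) (k n : nat) (le_kn : (k <= n)%N)
    (a : 'I_k -> sympoly K k)
    (deg_a : forall i : 'I_k, deg_lt (a i) (n - k + i.+1)%N) :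
  is_basis (fun la : {la : intpart | Pkn k n la} =>
    residue (fun i : 'I_k => hS K k (n - k + i.+1)%N - a i)
            (schurS K k (val la))).
Proof.
set g := fun i => _; split=> [r la c la_inj E0|x]; last first.
  have [f ->] := residue_surj x.
  have [w [b [Ef [r [la [c Ew]]]]]] := sympoly_box_mod_ideal le_kn deg_a f.
  exists r, la, c; transitivity (residue g w); last first.
    rewrite Ew raddf_sum /=; apply: eq_bigr => i _.
    exact: residueZ.
  by apply/residueE/boolp.asboolP; exists b; rewrite Ef addrAC subrr add0r.
(* The relation is lifted to symmetric polynomials: [f] lies in the ideal and will turn out to be 0,
   so the Schur polynomials themselves decide. *)
pose f := \sum_(i < r) c i *: schurS K k (val (la i)).
have /residueE : residue g f = residue g 0.
  rewrite raddf0 -[RHS]E0 raddf_sum.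
  by apply: eq_bigr => i _; exact: residueZ.
rewrite subr0 => /boolp.asboolP [b Ef].
have valf : val f = \sum_(i < r) c i *: schur K k (val (la i)).
  by rewrite raddf_sum.
have box_la i : (size (val (la i)) <= k)%N /\ (nth 0%N (val (la i)) 0 <= n - k)%N.
  have /andP[le_k /(all_nthP 0%N) le_n] := valP (la i); split=> //.
  by have [/le_n|] := ltnP 0 (size (val (la i))) => // ?; rewrite nth_default.
apply: (schur_independent (k := k) (la := fun i => val (la i))).
- by move=> i j /val_inj/la_inj.
- by move=> i; have [] := box_la i.
rewrite -valf; apply: (ideal_box_eq0 deg_a (b := b)).
  by rewrite Ef raddf_sum; exact: eq_bigr.
(* Each monomial of [f] is a tableau weight, with exponents at most the first part. *)
move=> m; rewrite valf raddf_sum => nz_m v.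
have [/existsP [i nz_i]|] :=
  boolP [exists i, (schur K k (val (la i)))@_m != 0].
  have [T ssT <-] := schur_supp nz_i.
  by apply: leq_trans (weight_le_row v ssT) _; have [] := box_la i.
rewrite negb_exists => /forallP h; case/eqP: nz_m; rewrite big1 // => i _.
by rewrite /= mcoeffZ; have := h i; rewrite negbK => /eqP ->; rewrite mulr0.
Qed.
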